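(* Let $\mathcal G=(\mathcal V,\mathcal E)$ be a locally finite graph, $x,y\in\mathcal V$, and let $B\subset\mathcal V$ be a finite set that separates $x$ from $y$, i.e. every path from $x$ to $y$ along edges of $\mathcal G$ intersects $B$. Let $\mathcal G_B$ be the subgraph of $\mathcal G$ induced on the union of $B$ with the set of vertices that can be reached from $x$ by a path avoiding $B$. Then for every $\beta\in(0,\infty)$, $$\langle\sigma_x\cdot\sigma_y\rangle^{\mathrm{Vill},\mathcal G}_\beta\ \le\ \sum_{u\in B}\langle\sigma_x\cdot\sigma_u\rangle^{\mathrm{Vill},\mathcal G_B}_\beta\,\langle\sigma_u\cdot\sigma_y\rangle^{\mathrm{Vill},\mathcal G}_\beta\ \le\ \sum_{u\in B}\langle\sigma_x\cdot\sigma_u\rangle^{\mathrm{Vill},\mathcal G}_\beta\,\langle\sigma_u\cdot\sigma_y\rangle^{\mathrm{Vill},\mathcal G}_\beta ,$$ where the correlations on $\mathcal G_B$ are those of the Villain model with free boundary conditions.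
   Context: Villain model: on a finite graph $(V,E)$ with free boundary conditions at inverse temperature $\beta$, the spins are $\sigma_x=e^{i\theta_x}\in\mathbb S^1$, $\theta\in[-\pi,\pi)^V$, with probability density proportional to $\prod_{\{u,v\}\in E}\sum_{m\in\mathbb Z}\exp\big(-\frac\beta2(\theta_u-\theta_v+2\pi m)^2\big)$, and $\langle\sigma_x\cdot\sigma_y\rangle$ is the expectation of $\cos(\theta_x-\theta_y)$. On an infinite locally finite graph the correlation $\langle\sigma_x\cdot\sigma_y\rangle^{\mathrm{Vill},\cdot}_\beta$ is the limit of the finite-graph correlations along increasing finite subgraphs exhausting the graph (the finite-volume correlations are monotone in the volume). *)

(* Defs.v *)
From HB Require Import structures.
From mathcomp Require Import all_boot all_order all_algebra finmap.
From mathcomp Require Import all_classical all_reals all_analysis.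
Set Implicit Arguments.
Unset Strict Implicit.
Unset Printing Implicit Defensive.
Import Order.TTheory GRing.Theory Num.Theory.
Import numFieldNormedType.Exports.
Local Open Scope classical_set_scope.
Local Open Scope ring_scope.

(* Simple graphs, possibly infinite, whose vertices lie in an ambient type V.
   Subgraphs of a graph are then graphs over the same V. *)
Record graph (V : choiceType) := Graph {
  verts : set V;
  edge : rel V;
  edge_sym : symmetric edge;
  edge_irr : irreflexive edge;
  edge_verts : forall u v, edge u v -> verts u
}.

Section Graphs.
Variable V : choiceType.
Implicit Types G H : graph V.

Definition locally_finite G := forall v, finite_set [set w | edge G v w].

Definition subgraph H G :=
  verts H `<=` verts G /\ (forall u v, edge H u v -> edge G u v).

Definition finite_subgraph H G := finite_set (verts H) /\ subgraph H G.

Definition induced_edge G (W : set V) : rel V :=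
  fun u v => [&& u \in W, v \in W & edge G u v].

Lemma induced_edge_sym G W : symmetric (induced_edge G W).
Proof. by move=> u v; rewrite /induced_edge edge_sym andbCA. Qed.

Lemma induced_edge_irr G W : irreflexive (induced_edge G W).
Proof. by move=> u; rewrite /induced_edge edge_irr !andbF. Qed.

Lemma induced_edge_verts G W u v :
  induced_edge G W u v -> (verts G `&` W) u.
Proof. by case/and3P=> /set_mem Wu _ /edge_verts. Qed.

Definition induced G W : graph V :=
  Graph (@induced_edge_sym G W) (@induced_edge_irr G W)
        (@induced_edge_verts G W).

(* A walk from x is x :: p; both of its endpoints count as visited. *)
Definition separates G (B : {fset V}) (x y : V) :=
  forall p : seq V, path (edge G) x p -> last x p = y ->
    has (fun v => v \in B) (x :: p).

Definition reachable_avoiding G (B : {fset V}) (x : V) : set V :=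
  [set v | exists p : seq V, [/\ path (edge G) x p, last x p = v
                              & ~~ has (fun w => w \in B) (x :: p)]].

Definition separated_part G (B : {fset V}) (x : V) : graph V :=
  induced G ([set` B] `|` reachable_avoiding G B x).

(* The filter of finite subgraphs of G directed by inclusion: limits along it
   are limits along finite subgraphs increasing to G. *)
Definition exhaustion G : set_system (graph V) :=
  [set P | exists2 H0, finite_subgraph H0 G &
     forall H, finite_subgraph H G -> subgraph H0 H -> P H].

End Graphs.

Section Lebesgue.
Variable R : realType.

Definition cons_tuple n (p : n.-tuple R * R) : n.+1.-tuple R :=
  [the n.+1.-tuple R of p.2 :: p.1].

Lemma measurable_cons_tuple n : measurable_fun setT (@cons_tuple n).
Proof. exact: measurable_cons measurable_snd measurable_fst. Qed.

Section Step.
Variables (n : nat) (mu : {measure set (n.-tuple R) -> \bar R}).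

Definition lebesgue_cons : set (n.+1.-tuple R) -> \bar R :=
  pushforward (mu \x (@lebesgue_measure R))%E (@cons_tuple n).

HB.instance Definition _ := Measure.copy lebesgue_cons
  (measure_function_pushforward__canonical__measure_function_Measure
     (mu \x (@lebesgue_measure R))%E (@measurable_cons_tuple n)).

End Step.

(* Lebesgue measure on R^n, as an iterated product measure *)
Fixpoint lebesgue_tuple (n : nat) : {measure set (n.-tuple R) -> \bar R} :=
  match n with
  | 0 => \d_ ([tuple] : 0.-tuple R)
  | n'.+1 => lebesgue_cons (lebesgue_tuple n')
  end.

End Lebesgue.

Section Villain.
Variables (R : realType) (V : choiceType).

Definition villain_weight (beta t : R) : R :=
  fine (\esum_(m in [set: int])
          (expR (- (beta / 2) * (t + 2 * pi * m%:~R) ^+ 2))%:E).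

Section FiniteVolume.
Variables (H : graph V) (beta : R).

(* meaningful when verts H is finite *)
Definition vseq : seq V := enum_fset (fset_set (verts H)).

Definition configuration := (size vseq).-tuple R.

Definition angles : set configuration :=
  [set theta | forall i, - pi <= tnth theta i < pi].

(* junk value 0 when v is not a vertex of H *)
Definition angle (theta : configuration) (v : V) : R :=
  nth 0 theta (index v vseq).

(* Each unordered edge occurs once, oriented along the enumeration of the
   vertices; the orientation is irrelevant as villain_weight is even. *)
Definition villain_density (theta : configuration) : R :=
  \prod_(u <- vseq)
    \prod_(v <- vseq | edge H u v && (index u vseq < index v vseq)%N)
      villain_weight beta (angle theta u - angle theta v).

Definition villain_expectation (f : configuration -> R) : R :=
  (\int[lebesgue_tuple R (size vseq)]_(theta in angles)
      (f theta * villain_density theta)) /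
  (\int[lebesgue_tuple R (size vseq)]_(theta in angles)
      villain_density theta).

Definition finite_villain_corr (x y : V) : R :=
  villain_expectation (fun theta => cos (angle theta x - angle theta y)).

End FiniteVolume.

Definition villain_corr (G : graph V) (beta : R) (x y : V) : R :=
  lim (finite_villain_corr H beta x y @[H --> exhaustion G]).

End Villain.

(* Main.v *)
(** The product w(t) w(t') of two Villain weights at inverse temperature b equals
    W(a) W(g) + W(a + pi) W(g + pi), where W is the weight at 2b, a = (t + t')/2
    and g = (t - t')/2; each weight is a limit of polynomials in cos with
    nonnegative coefficients.  After this rotation of a pair of independent
    systems, the two halves decouple, and every product of two correlation
    integrals is a limit of nonnegative combinations of products of counts: the
    number of ways to direct a multiset of edges so that its divergence cancels
    a prescribed charge.  For the Lieb inequality the required comparison of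
    counts is obtained by deleting edges one at a time along a walk from x until
    B is hit.  For the Ginibre inequality, i.e. monotonicity in the volume, it is
    2 m n <= m^2 + n^2.  Monotonicity makes the infinite-volume correlations
    suprema over finite subgraphs, to which the finite inequalities pass. *)

From HB Require Import structures.
Require Import Defs.
From mathcomp Require Import all_boot all_order all_algebra finmap.
From mathcomp Require Import all_classical all_reals all_analysis.
From mathcomp Require Import measurable_realfun lra zify.
Import Order.TTheory GRing.Theory Num.Theory.
Import numFieldNormedType.Exports.
Set Implicit Arguments.
Unset Strict Implicit.
Unset Printing Implicit Defensive.
Local Open Scope classical_set_scope.
Local Open Scope ring_scope.

(** The half-angles a and g are not functions on the torus, so rotating the pair does not by itself
    decouple it. A cosine with charges P on a and Q on g is an honest function of the original
    angles only if (P + Q)/2 and (P - Q)/2 are integer charges. The second term W(a + pi) W(g + pi)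
    provides this: after expansion, an edge occurs i times in a and j times in g with i and j of
    equal parity. Fixing a parity on every edge yields a family of terms whose integral factors into
    two counts. The two systems live on a graph and on a subgraph, and only edges of the subgraph
    are rotated. A remaining edge involves the first angle alone and shifts P and Q by the same D.
    Charges p and p' on the two systems become P = p + p' and Q = p - p'. In the Lieb inequality the
    left side (x - y, 0) gives P = Q = x - y, and the term (u - y, x - u) on the right gives P = x -
    y and Q = 2u - x - y. The P factor is common, so only the count with charge x - y has to be
    compared with those where x is reflected in u: a linear statement. *)

Lemma addf_apply (T : Type) (f g : T -> int) x : (f + g) x = f x + g x.
Proof. by []. Qed.

Lemma oppf_apply (T : Type) (f : T -> int) x : (- f) x = - f x.
Proof. by []. Qed.

Definition fun_applyE := (addf_apply, oppf_apply).

(** * Counting orientations of an edge multiset with prescribed divergence *)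

Section OrientationCount.
Variables (R : realFieldType) (V : choiceType).
Implicit Types (s b : seq V) (e : V * V) (L : seq (V * V)) (P D : V -> int).

Definition dlt (u : V) : V -> int := fun v => (v == u)%:R.

Definition bdry e : V -> int := dlt e.1 - dlt e.2.

(* Counts the sign choices on L for which P + sum_e (+/-) bdry e vanishes on s *)
Fixpoint orient_count s L P : R :=
  if L is e :: L' then orient_count s L' (P + bdry e) + orient_count s L' (P - bdry e)
  else (all (fun v => P v == 0) s)%:R.

Lemma orient_count_ge0 s L P : 0 <= orient_count s L P.
Proof. by elim: L P => [|e L IH] P /=; [exact: ler0n | exact: addr_ge0]. Qed.

(** Reversing all directions is a bijection of the counted choices. It allows the removal identity
    to be used where the charge is -1. *)
Lemma orient_countN s L P : orient_count s L (- P) = orient_count s L P.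
Proof.
elim: L P => [|e L IH] P /=.
  by congr ((nat_of_bool _)%:R); apply: eq_all => v; rewrite fun_applyE oppr_eq0.
by rewrite -(IH (P + bdry e)) -(IH (P - bdry e)) !opprD !opprK addrC.
Qed.

Definition incident (x : V) e := (e.1 == x) || (e.2 == x).

Definition other (x : V) e := if e.1 == x then e.2 else e.1.

(** Removal is by occurrence, not by value: [L] stands for a multiset in which an edge may be
    repeated, and each copy is a separate choice for the walk. *)
Fixpoint removals L : seq ((V * V) * seq (V * V)) :=
  if L is e :: L' then (e, L') :: [seq (p.1, e :: p.2) | p <- removals L']
  else [::].

Lemma removals_mem L p : p \in removals L ->
  [/\ p.1 \in L, {subset p.2 <= L} & size L = (size p.2).+1].
Proof.
elim: L p => [//|e L IH] p /=; rewrite inE => /orP[/eqP -> /=|/mapP[q /IH[q1 q2 q3] ->] /=].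
  by rewrite mem_head; split => // f fL; rewrite inE fL orbT.
rewrite inE q1 orbT q3; split => // f; rewrite !inE => /orP[->//|/q2 ->].
by rewrite orbT.
Qed.

Definition degree L x := count (incident x) L.

Lemma bdry_incident x e : e.1 != e.2 -> incident x e ->
  bdry e = dlt x - dlt (other x e) \/ bdry e = dlt (other x e) - dlt x.
Proof.
case: e => u v /=; rewrite /incident /other /bdry /= => uv.
by have [->|ux /= /eqP ->] := eqVneq u x; [left | right].
Qed.

Lemma dltxx u : dlt u u = 1. Proof. by rewrite /dlt eqxx. Qed.

Lemma other_neq x e : e.1 != e.2 -> incident x e -> dlt (other x e) x = 0.
Proof.
case: e => u v /=; rewrite /incident /other /dlt /=.
by case: (eqVneq u x) => [-> /negPf -> | /negPf ux _ _] //; rewrite eq_sym ux.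
Qed.

Lemma bdry_nincident x e : ~~ incident x e -> bdry e x = 0.
Proof.
by rewrite /incident negb_or /bdry /dlt !fun_applyE !(eq_sym x) => /andP[/negPf -> /negPf ->].
Qed.

(* Double counting of pairs (orientation, edge pointing into x). *)
Lemma orient_count_removals s L x D : x \in s ->
  {in L, forall e, e.1 != e.2} ->
  2 * \sum_(p <- removals L | incident x p.1)
      orient_count s p.2 (D + dlt (other x p.1) - dlt x) =
  ((degree L x)%:R + (D x)%:~R) * orient_count s L D.
Proof.
move=> xs; elim: L D => [|e L IH] D ne /=.
  rewrite big_nil mulr0 add0r; case: allP => [/(_ x xs) /eqP ->|]; rewrite ?mulr0//.
  by rewrite mul0r.
have neL : {in L, forall e, e.1 != e.2} by move=> f fL; apply: ne; rewrite inE fL orbT.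
have nee : e.1 != e.2 by apply: ne; rewrite mem_head.
rewrite big_cons big_map /= big_split /= /degree /= -/(degree L x).
have sw (f : V * V) (g : V -> int): D + dlt (other x f) - dlt x + g = (D + g) + dlt (other x f) - dlt x.
  by rewrite -!addrA; congr (_ + _); rewrite [LHS]addrA addrC.
have eq1 (g : V -> int) : \sum_(p <- removals L | incident x p.1)
    orient_count s p.2 (D + dlt (other x p.1) - dlt x + g) =
  \sum_(p <- removals L | incident x p.1)
    orient_count s p.2 ((D + g) + dlt (other x p.1) - dlt x).
  by apply: eq_bigr => p _; rewrite sw.
rewrite !eq1.
have := IH (D + bdry e) neL; have := IH (D - bdry e) neL.
set S2 := (X in 2 * X = _ -> _); set S1 := (X in _ -> 2 * X = _ -> _).
rewrite !fun_applyE => I2 I1.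
case: ifPn => xe; last first.
  rewrite (bdry_nincident xe) in I1 I2.
  rewrite mulrDr I1 I2 oppr0 !addr0 add0n; lra.
rewrite [(true + _)%N]add1n -natr1 !mulrDr I1 I2.
have xo := other_neq nee xe.
have x1 := dltxx x.
(* For the direction of [e] with charge -1 at [x], the inductive factor is [degree L x + D x - 1],
   two short of the required [degree L x + 1 + D x]. The removal of [e] itself, counted with its
   factor 2, makes up the difference; the other direction already has the right factor. *)
have [eb|eb] := bdry_incident nee xe.
  have -> : D + dlt (other x e) - dlt x = D - bdry e by rewrite eb opprB addrA.
  rewrite eb !fun_applyE xo x1 subr0 !rmorphD /= !rmorphN /= !rmorph1; lra.
have -> : D + dlt (other x e) - dlt x = D + bdry e by rewrite eb addrA.
rewrite eb !fun_applyE xo x1 sub0r !rmorphD /= !rmorphN /= !rmorph1; lra.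
Qed.

(* Walk from x along a uniformly chosen edge pointing into the current vertex,
   deleting it, until b is hit; deleting the same edges pointing the other way
   produces the terms on the right-hand side. *)
Lemma orient_count_lieb s b L x P :
  x \in s -> x \notin b -> P x = 0 ->
  {in L, forall e, e.1 != e.2} ->
  {in L, forall e v, v \in [:: e.1; e.2] -> v \in s /\ (v \notin b -> P v = 0)} ->
  orient_count s L (dlt x - P) <=
  \sum_(u <- b) orient_count s L (dlt u + dlt u - dlt x - P).
Proof.
move En : (size L) => n.
elim: n => [|n IH] in L En x *.
  case: L En => // _ xs xb Px _ _ /=.
  (* Without edges the unit charge at [x] cannot be cancelled, so the left side is 0. *)
  suff -> : all (fun v => (dlt x - P) v == 0) s = false.
    by apply: sumr_ge0 => u _; rewrite ler0n.
  apply/negbTE/allPn; exists x => //.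
  by rewrite /dlt !fun_applyE Px eqxx subr0 oner_eq0.
move=> xs xb Px ne supp.
have pos : 0 < (degree L x)%:R + 1 :> R by rewrite ltr_wpDl.
rewrite -(ler_pM2l pos).
have := @orient_count_removals s L x (dlt x - P) xs ne.
rewrite !fun_applyE Px subr0 dltxx rmorph1 => <-.
rewrite [leRHS]mulr_sumr.
have step u : u \in b -> ((degree L x)%:R + 1) * orient_count s L (dlt u + dlt u - dlt x - P) =
    2 * \sum_(p <- removals L | incident x p.1)
      orient_count s p.2 (dlt u + dlt u - dlt (other x p.1) - P).
  (* The charge at [x] is -1 here, as [u] differs from [x] and [P x = 0]. Negating all charges makes
     it 1, so that the factor agrees with the one on the left side and cancels. *)
  move=> ub; rewrite -orient_countN.
  have := @orient_count_removals s L x (- (dlt u + dlt u - dlt x - P)) xs ne.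
  have ux : (x == u) = false by apply/negP => /eqP xu; rewrite xu ub in xb.
  have dux : dlt u x = 0 by rewrite /dlt ux.
  have -> : (- (dlt u + dlt u - dlt x - P)) x = 1 by rewrite !fun_applyE Px dltxx dux.
  rewrite rmorph1 => <-.
  congr (_ * _); apply: eq_bigr => p _; rewrite -orient_countN; congr orient_count.
  apply/funext => v; rewrite !fun_applyE; lia.
rewrite [leRHS]big_seq (eq_bigr _ step) -big_seq.
rewrite -[leRHS]mulr_sumr ler_pM2l// exchange_big /=.
rewrite big_seq_cond [leRHS]big_seq_cond; apply: ler_sum => p /andP[pL xp].
have [p1 p2 p3] := removals_mem pL.
have -> : dlt x - P + dlt (other x p.1) - dlt x = dlt (other x p.1) - P.
  by apply/funext => v; rewrite !fun_applyE; lia.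
have oth : other x p.1 \in [:: p.1.1; p.1.2].
  by rewrite /other; case: ifP; rewrite !inE eqxx ?orbT.
have [os oP] := supp _ p1 _ oth.
(* Off [b], the other endpoint is the next position of the walk and induction applies. On [b], the
   term with [u] equal to that endpoint has [dlt u + dlt u - dlt u = dlt u], hence equals the left
   side by itself, and the other terms are nonnegative. *)
have [ob|ob] := boolP (other x p.1 \in b); last first.
  apply: IH => //; first by move: p3; rewrite En => -[].
  - exact: oP.
  - by move=> f /p2; exact: ne.
  - by move=> f /p2; exact: supp.
rewrite (big_rem _ ob) /= -[leLHS]addr0; apply: lerD; last first.
  by apply: sumr_ge0 => u _; exact: orient_count_ge0.
by rewrite addrK.
Qed.

End OrientationCount.

(** * Gaussian upper and lower bounds on the cosine *)

Section CosineBounds.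
Variable R : realType.
Implicit Types x y : R.

Lemma ler_mul_cos_sin y : 0 <= y <= pi / 2 -> y * cos y <= sin y.
Proof.
move=> /andP[y0 y1].
pose f := fun x : R => sin x - x * cos x.
have df (x : R) : is_derive x (1 : R) f (x * sin x).
  by apply: is_derive_eq; rewrite /GRing.scale/=; lra.
have cf : {within `[0, pi / 2], continuous f}.
  by apply: derivable_within_continuous => x _; exact: ex_derive.
have := @ger0_derive1_le_cc R f 0 (pi / 2) (fun x _ => @ex_derive _ _ _ _ _ _ _ (df x)).
have d0 x : x \in `]0, (pi / 2)[%R -> 0 <= derive1 f x.
  rewrite in_itv /= => /andP[x0 x1]; rewrite derive1E (@derive_val _ _ _ _ _ _ _ (df x)).
  by rewrite mulr_ge0 ?(ltW x0)// sin_ge0_pi// (ltW x0) (le_trans (ltW x1))// ler_pdivrMr// ler_peMr// ?pi_ge0// ler1n.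
move=> /(_ d0 cf 0 y); rewrite !in_itv/= lexx y0 y1 /= divr_ge0 ?pi_ge0// => /(_ isT isT isT).
by rewrite /f sin0 mul0r subr0 subr_ge0.
Qed.

(** The function [cos x * expR (x ^+ 2 / 2)] equals 1 at 0 and is nonincreasing on [0, pi/2], since
    its derivative has the sign of [x * cos x - sin x]. *)
Lemma cos_le_expR y : - (pi / 2) <= y <= pi / 2 -> cos y <= expR (- (y ^+ 2 / 2)).
Proof.
wlog y0 : y / 0 <= y => [hw|].
  have [y0|y0] := leP 0 y; first exact: hw.
  by move=> /andP[y1 y2]; rewrite -(cosN y) -(sqrrN y); apply: hw; [lra | lra].
move=> /andP[_ y1].
pose f := fun x : R => cos x * expR (x ^+ 2 / 2).
have df (x : R) : is_derive x (1 : R) f ((x * cos x - sin x) * expR (x ^+ 2 / 2)).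
  have dE : is_derive x (1 : R) (fun z => expR (z ^+ 2 / 2)) (expR (x ^+ 2 / 2) * x).
    apply: is_derive_eq; rewrite /GRing.scale/= ?expr1; lra.
  by apply: is_derive_eq; rewrite /GRing.scale/=; lra.
have cf : {within `[0, pi / 2], continuous f}.
  by apply: derivable_within_continuous => x _; exact: ex_derive.
have := @ler0_derive1_le_cc R f 0 (pi / 2) (fun x _ => @ex_derive _ _ _ _ _ _ _ (df x)).
have d0 x : x \in `]0, (pi / 2)[%R -> derive1 f x <= 0.
  rewrite in_itv /= => /andP[x0 x1]; rewrite derive1E (@derive_val _ _ _ _ _ _ _ (df x)).
  by rewrite pmulr_lle0 ?expR_gt0// subr_le0 ler_mul_cos_sin// !ltW.
move=> /(_ d0 cf y 0); rewrite !in_itv/= lexx y0 y1 /= divr_ge0 ?pi_ge0// => /(_ isT isT isT).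
rewrite /f cos0 expr0n/= mul0r expR0 mulr1.
by rewrite expRN -ler_pdivlMr ?expR_gt0// mul1r.
Qed.

Lemma ler_norm_sin x : `|sin x| <= `|x|.
Proof.
wlog x0 : x / 0 <= x => [hw|].
  have [x0|x0] := leP 0 x; first exact: hw.
  by rewrite -(normrN x) -(normrN (sin x)) -sinN; apply: hw; lra.
have [x1|x1] := leP x 1; last first.
  rewrite (le_trans (sin_max x))// ger0_norm// ltW//.
have xp : x <= pi by rewrite (le_trans x1)// (le_trans _ (pi_ge2 R))// ler1n.
rewrite !ger0_norm ?sin_ge0_pi ?x0//.
pose f := fun z : R => z - sin z.
have df (z : R) : is_derive z (1 : R) f (1 - cos z).
  by apply: is_derive_eq; rewrite /GRing.scale/=; lra.
have cf : {within `[0, 1], continuous f}.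
  by apply: derivable_within_continuous => z _; exact: ex_derive.
have := @ger0_derive1_le_cc R f 0 1 (fun z _ => @ex_derive _ _ _ _ _ _ _ (df z)).
have d0 z : z \in `]0, 1[%R -> 0 <= derive1 f z.
  by move=> _; rewrite derive1E (@derive_val _ _ _ _ _ _ _ (df z)) subr_ge0 cos_le1.
move=> /(_ d0 cf 0 x); rewrite !in_itv/= lexx x0 x1 /= ler01 => /(_ isT isT isT).
by rewrite /f sin0 subr0 subr_ge0.
Qed.

(** With z = y^2 / (1 - y^2) one has 1 / (1 - y^2) = 1 + z <= exp z, hence exp(-z) <= 1 - y^2 <= 1 -
    sin^2 y. *)
Lemma sqr_cos_ge_expR y : `|y| < 1 -> expR (- (y ^+ 2 / (1 - y ^+ 2))) <= cos y ^+ 2.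
Proof.
move=> y1; have v1 : 0 < 1 - y ^+ 2.
  by rewrite subr_gt0 -real_normK ?num_real// expr_lt1.
apply: (@le_trans _ _ (1 - y ^+ 2)); last first.
  rewrite cos2sin2 lerD2l lerN2 -(real_normK (num_real (sin y))) -(real_normK (num_real y)).
  by rewrite ler_sqr ?nnegrE// ler_norm_sin.
rewrite expRN -[leRHS]invrK lef_pV2 ?posrE ?invr_gt0 ?expR_gt0//.
apply: le_trans (expR_ge1Dx _).
by rewrite -[X in _ <= X + _](divff (lt0r_neq0 v1)) -mulrDl subrK mul1r.
Qed.

End CosineBounds.

(** * Dominated convergence for series *)

Section Tannery.
Variable R : realType.

(* Tannery's theorem with a moving truncation *)
Lemma cvg_sum_dominated (u : nat -> nat -> R) (z v : nat -> R) (Z : R) (N : nat -> nat) :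
  (forall k, u a k @[a --> \oo] --> z k) ->
  (\forall a \near \oo, forall k, (k < N a)%N -> `|u a k| <= v k) ->
  cvg (series v @ \oo) ->
  (forall n, \forall a \near \oo, (n <= N a)%N) ->
  series z @ \oo --> Z ->
  \sum_(0 <= k < N a) u a k @[a --> \oo] --> Z.
Proof.
move=> uz uv cv cN zZ; apply/cvgrPdist_le => e e0.
have e3 : 0 < e / 3 by rewrite divr_gt0.
have /cauchy_cvgP/cauchy_seriesP/(_ _ e3) := cv.
move=> [[A B] /= [[nA _ A1] [nB _ B1]]] AB.
have [nZ _ ZP] : \forall n \near \oo, `|Z - series z n| <= e / 3.
  by move/cvgrPdist_le : zZ => /(_ _ e3).
(* Past [K] the tails of [v] dominate and are small, and the partial sum of [z] at [K] is close to
   [Z]; below [K] only finitely many terms have to converge. *)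
pose K := maxn (maxn nA nB) nZ.
have KA : A K by apply: A1; rewrite /= /K !leq_max leqnn.
have KB n : (K <= n)%N -> B n.
  by move=> Kn; apply: B1; rewrite /= (leq_trans _ Kn)// /K !leq_max leqnn orbT.
have KZ : `|Z - series z K| <= e / 3 by apply: ZP; rewrite /= /K leq_max leqnn orbT.
have sz : \sum_(0 <= k < K) u a k @[a --> \oo] --> \sum_(0 <= k < K) z k.
  by apply: cvg_big => [|k _]; [exact: add_continuous | exact: uz].
near=> a.
have aN : (K <= N a)%N by near: a; exact: cN.
have ua : forall k, (k < N a)%N -> `|u a k| <= v k by near: a; exact: uv.
have ka : `|\sum_(0 <= k < K) z k - \sum_(0 <= k < K) u a k| <= e / 3.
  by near: a; move/cvgrPdist_le : sz => /(_ _ e3).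
have ta : `|\sum_(K <= k < N a) u a k| <= e / 3.
  apply: ltW; apply: le_lt_trans (AB (K, N a) _); last by split => //=; exact: KB.
  apply: le_trans (ler_norm_sum _ _ _) (le_trans _ (ler_norm _)) => /=.
  by rewrite big_nat_cond [leRHS]big_nat_cond; apply: ler_sum => k /andP[/andP[_ kN] _]; exact: ua.
rewrite (big_cat_nat (leq0n K) aN)/=.
rewrite (_ : Z - _ = (Z - series z K) +
   (\sum_(0 <= k < K) z k - \sum_(0 <= k < K) u a k) - \sum_(K <= k < N a) u a k); last first.
  by rewrite /series /=; lra.
rewrite (le_trans (ler_normB _ _))//.
have := ler_normD (Z - series z K) (\sum_(0 <= k < K) z k - \sum_(0 <= k < K) u a k).
by lra.
Unshelve. all: by end_near. Qed.

End Tannery.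

(** * Sums of a polynomial in the cosine over equally spaced angles *)

Section CosCone.
Variable R : realType.
Lemma horner_even_poly (p : {poly R}) y :
  p.[y] + p.[- y] = 2 * (even_poly p).[y ^+ 2].
Proof.
rewrite -{1 2}[p]poly_even_odd.
rewrite !hornerE !horner_comp !hornerE !sqrrN /=; lra.
Qed.

Lemma polyOver_even_poly (p : {poly R}) : p \is a polyOver Num.nneg -> even_poly p \is a polyOver Num.nneg.
Proof. by move=> /polyOverP pp; apply/polyOverP => i; rewrite coef_even_poly. Qed.

(** Pairing [k] with [k + 2 ^ a] shifts the angle by pi and changes the sign of its cosine y,
    leaving twice the even part of [p]. This is a polynomial in y^2 = (1 + cos of the doubled angle)
    / 2, still with nonnegative coefficients, and the number of angles has been halved. *)
Lemma sum_cos_poly (a : nat) (p : {poly R}) : p \is a polyOver Num.nneg ->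
  exists2 q : {poly R}, q \is a polyOver Num.nneg &
  forall t, \sum_(0 <= k < 2 ^ a) p.[cos ((t + 2 * pi * k%:R) / (2 ^ a)%:R)] = q.[cos t].
Proof.
elim: a p => [|a IH] p pp.
  by exists p => // t; rewrite expn0 big_nat1 mulr0 addr0 divr1.
pose q := 2 *: (even_poly p \Po (2^-1 *: ('X + 1))).
have qq : q \is a polyOver Num.nneg.
  rewrite polyOverZ ?nnegrE//; apply: polyOver_comp; first exact: polyOver_even_poly.
  by rewrite polyOverZ ?nnegrE// rpredD ?rpred1// polyOverX.
have [r rr Hr] := IH q qq; exists r => // t; rewrite -Hr.
have -> : (2 ^ a.+1 = 2 ^ a + 2 ^ a)%N by rewrite expnS mul2n addnn.
rewrite (big_cat_nat (leq0n (2 ^ a)) (leq_addr _ _))/=.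
set h := (2 ^ a)%N; have addh F : \sum_(h <= k < h + h) F k = \sum_(0 <= k < h) F (k + h)%N :> R.
  by rewrite -{1}[h]add0n big_addn addnK.
rewrite addh -big_split /=.
apply: eq_bigr => k _.
have l0 : h%:R != 0 :> R by rewrite pnatr_eq0 expn_eq0.
set l : R := h%:R in l0 *.
rewrite natrD -/l.
have ll0 : l + l != 0 by rewrite -mulr2n mulrn_eq0.
set y := (t + 2 * pi * k%:R) / (l + l).
have -> : (t + 2 * pi * (k + h)%:R) / (l + l) = y + pi.
  by apply: (mulIf ll0); rewrite divfK// [RHS]mulrDl /y divfK// natrD -/l; lra.
have -> : (t + 2 * pi * k%:R) / l = y *+ 2.
  by apply: (mulIf ll0); rewrite [RHS]mulrnAl /y divfK// mulrDr divfK// -[RHS]mulr2n.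
rewrite cosDpi cos_mulr2n horner_even_poly /q !hornerE horner_comp !hornerE.
congr (_ * _.[_]); rewrite -mulr_natr; lra.
Qed.
End CosCone.

(** * The Villain weight as a limit of sums of cosine powers *)

Section VillainWeight.
Variable R : realType.
Implicit Types b t x : R.

Lemma esum_intE (f : int -> \bar R) : (forall k, 0 <= f k)%E ->
  (\esum_(m in [set: int]) f m =
   \sum_(k <oo) f (Posz k) + \sum_(k <oo) f (Negz k))%E.
Proof.
move=> f0; rewrite (esumID (range Posz)) ?setTI//.
have -> : ~` range Posz = range Negz.
  apply/seteqP; split => [[k|k] //= | k [n _ <-] /= [m _ //]].
    by move=> /(_ (ex_intro2 _ _ k I erefl)).
  by move=> _; exists k.
rewrite !esum_image -?nneseries_esumT//.
- by move=> i j _ _ [].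
- by move=> i j _ _ [].
Qed.

Lemma esum_int (f : int -> R) (Z : R) : (forall k, 0 <= f k) ->
  series (fun k => f (Posz k) + f (Negz k)) @ \oo --> Z ->
  \esum_(m in [set: int]) (f m)%:E = Z%:E.
Proof.
move=> f0 fZ; rewrite esum_intE => [|k]; last by rewrite lee_fin.
rewrite -nneseriesD => [|n _|n _]; rewrite ?lee_fin//.
rewrite (_ : (fun n => _) = EFin \o series (fun k => f (Posz k) + f (Negz k))); last first.
  by apply/funext => n; rewrite /= /series/= -sumEFin; apply: eq_bigr.
by apply/cvg_lim => //; apply: cvg_EFin => //; exact: nearW.
Qed.

Definition weight_term b t (k : int) := expR (- (b / 2) * (t + 2 * pi * k%:~R) ^+ 2).

Lemma weight_term_ge0 b t k : 0 <= weight_term b t k.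
Proof. exact: expR_ge0. Qed.

(** A bound linear in [k] suffices: it dominates the Gaussian terms and their approximants by one
    geometric series of ratio [expR (- (b / 4))]. *)
Lemma shift_sqr_ge t (k : nat) : 0 <= t <= pi ->
  k%:R <= (t + 2 * pi * (Posz k)%:~R) ^+ 2 /\ k%:R <= (t + 2 * pi * (Negz k)%:~R) ^+ 2.
Proof.
move=> /andP[t0 t1]; have p2 := pi_ge2 R.
have k0 : 0 <= k%:R :> R by [].
have kk : k%:R <= (k%:R : R) ^+ 2.
  by rewrite -natrX ler_nat expnS expn1; case: (k) => // n; rewrite leq_pmulr.
have kp : k%:R <= k%:R * pi :> R by rewrite ler_peMr//; lra.
split; apply: (le_trans kk).
  by rewrite ler_sqr ?nnegrE -?[(Posz k)%:~R]/(k%:R)//; nra.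
rewrite NegzE mulrNz -[(Posz k.+1)%:~R]/(k.+1%:R) -natr1 -[leRHS]sqrrN ler_sqr ?nnegrE; nra.
Qed.

(** Near y = 0, cos(y)^(2m) behaves like exp(-m y^2). For y = x / (2 * 2^(a+1)) and m close to 2 b
    4^(a+1), the product m y^2 tends to b x^2 / 2, the exponent in the Villain weight. *)
Definition approx_exp b a := Num.truncn (2 * b * (4 ^ a.+1)%:R).

Lemma cvg_approx_exp b : 0 < b ->
  (approx_exp b a)%:R / (4 ^ a.+1)%:R @[a --> \oo] --> 2 * b.
Proof.
move=> b0.
apply: (@squeeze_cvgr _ _ _ _ (fun a => 2 * b - geometric 1 (4^-1) a.+1) (fun=> 2 * b)).
- near=> a.
  have n0 : 0 < (4 ^ a.+1)%:R :> R by rewrite ltr0n expn_gt0.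
  have /andP[h1 h2] : (approx_exp b a)%:R <= 2 * b * (4 ^ a.+1)%:R < (approx_exp b a).+1%:R.
    by apply: truncn_itv; rewrite !mulr_ge0// ltW.
  rewrite ler_pdivrMr// h1 andbT ler_pdivlMr// mulrBl /geometric/= mul1r natrX exprVn mulVf; last first.
    by rewrite expf_neq0.
  by rewrite lerBlDr natr1 -natrX ltW.
- rewrite -[X in _ --> X]subr0; apply: cvgB; first exact: cvg_cst.
  have := @cvg_geometric R 1 (4^-1); rewrite ger0_norm// .
  by rewrite -cvg_shiftS; apply; rewrite invf_lt1//; lra.
- exact: cvg_cst.
Unshelve. all: by end_near. Qed.

Lemma cvg_div_pow2 x : x / (2 * (2 ^ a.+1)%:R) @[a --> \oo] --> (0 : R).
Proof.
have := @cvg_geometric R (x / 2) (2^-1); rewrite ger0_norm//.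
rewrite -cvg_shiftS => /(_ _); rewrite invf_lt1// ltr1n => /(_ isT).
apply: cvg_trans; apply: near_eq_cvg; apply: nearW => a.
by rewrite /geometric/= natrX exprVn invfM mulrA.
Qed.

Lemma sqr_div_pow2 b x a :
  (approx_exp b a)%:R * (x / (2 * (2 ^ a.+1)%:R)) ^+ 2 =
  (approx_exp b a)%:R / (4 ^ a.+1)%:R * (x ^+ 2 / 4) :> R.
Proof.
have e : (2 * (2 ^ a.+1)%:R) ^+ 2 = 4 * (4 ^ a.+1)%:R :> R.
  by rewrite exprMn -!natrX -expnM mulnC expnM.
by rewrite expr_div_n e invfM; lra.
Qed.

Lemma cos_pow_le_expR (y : R) (m : nat) : - (pi / 2) <= y <= pi / 2 ->
  cos y ^+ (2 * m) <= expR (- (m%:R * y ^+ 2)).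
Proof.
move=> yp; rewrite exprM -mulrN expRM_natl.
rewrite lerXn2r ?nnegrE ?expR_ge0 ?sqr_ge0//.
have -> : - y ^+ 2 = 2%:R * - (y ^+ 2 / 2) by lra.
rewrite expRM_natl lerXn2r ?nnegrE ?expR_ge0 ?cos_ge0_pihalf//.
exact: cos_le_expR.
Qed.

Lemma cvg_cos_pow b x : 0 < b ->
  cos (x / (2 * (2 ^ a.+1)%:R)) ^+ (2 * approx_exp b a) @[a --> \oo] --> expR (- (b / 2) * x ^+ 2).
Proof.
move=> b0; have y0 := cvg_div_pow2 x; have cb := cvg_approx_exp b0.
set c := fun a => (approx_exp b a)%:R / (4 ^ a.+1)%:R : R in cb.
set y := fun a => x / (2 * (2 ^ a.+1)%:R) in y0.
have el : expR (- (b / 2) * x ^+ 2) = expR (- (2 * b * (x ^+ 2 / 4) / (1 - 0 ^+ 2))).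
  by congr expR; rewrite expr0n/= subr0 divr1; lra.
have eu : expR (- (b / 2) * x ^+ 2) = expR (- (2 * b * (x ^+ 2 / 4))).
  by congr expR; lra.
apply: (@squeeze_cvgr _ _ _ _ (fun a => expR (- (c a * (x ^+ 2 / 4) / (1 - y a ^+ 2))))
   (fun a => expR (- (c a * (x ^+ 2 / 4))))).
- near=> a.
  have y1 : `|y a| < 1.
    near: a; have := cvgr0_norm_lt _ y0; apply; exact: ltr01.
  have yp : - (pi / 2) <= y a <= pi / 2.
    have := pihalf_ge1 R; move: y1; rewrite ltr_norml => /andP[]; lra.
  rewrite -sqr_div_pow2 -/(y a) cos_pow_le_expR// andbT exprM.
  apply: (@le_trans _ _ (expR (- (y a ^+ 2 / (1 - y a ^+ 2))) ^+ approx_exp b a)).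
    by rewrite -expRM_natl mulrN -mulrA.
  by rewrite lerXn2r ?nnegrE ?expR_ge0 ?sqr_ge0// sqr_cos_ge_expR.
- rewrite el; apply: continuous_cvg; first exact: continuous_expR.
  apply: cvgN; apply: cvgM; first by apply: cvgM => //; exact: cvg_cst.
  apply: cvgV; first by rewrite expr0n subr0 oner_eq0.
  by apply: cvgB; [exact: cvg_cst | exact: (cvgM y0 y0)].
- rewrite eu; apply: continuous_cvg; first exact: continuous_expR.
  by apply: cvgN; apply: cvgM => //; exact: cvg_cst.
Unshelve. all: by end_near. Qed.

Definition approx_term b t a (k : int) :=
  cos ((t + 2 * pi * k%:~R) / (2 * (2 ^ a.+1)%:R)) ^+ (2 * approx_exp b a).

Lemma weight_term_le b t (k : nat) : 0 < b -> 0 <= t <= pi ->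
  weight_term b t (Posz k) <= expR (- (b / 4)) ^+ k /\
  weight_term b t (Negz k) <= expR (- (b / 4)) ^+ k.
Proof.
move=> b0 /(shift_sqr_ge k)[h1 h2]; have k0 : 0 <= k%:R :> R by [].
by split; rewrite -expRM_natr ler_expR; nra.
Qed.

(** The restriction [k < 2 ^ a] keeps the argument of the cosine in [-pi/2, pi/2], where the
    Gaussian upper bound holds. The lower bound [b] on the ratio holds for large [a], as the ratio
    tends to [2 * b]. *)
Lemma approx_term_le b t a (k : nat) : 0 < b -> 0 <= t <= pi ->
  b <= (approx_exp b a)%:R / (4 ^ a.+1)%:R -> (k < 2 ^ a)%N ->
  approx_term b t a (Posz k) <= expR (- (b / 4)) ^+ k /\
  approx_term b t a (Negz k) <= expR (- (b / 4)) ^+ k.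
Proof.
move=> b0 tp cb ka; have [h1 h2] := shift_sqr_ge k tp.
have k0 : 0 <= k%:R :> R by [].
have key x : - (pi / 2 * (2 * (2 ^ a.+1)%:R)) <= x <= pi / 2 * (2 * (2 ^ a.+1)%:R) ->
    k%:R <= x ^+ 2 ->
    cos (x / (2 * (2 ^ a.+1)%:R)) ^+ (2 * approx_exp b a) <= expR (- (b / 4)) ^+ k.
  move=> xp kx; apply: le_trans (cos_pow_le_expR _ _) _.
    by rewrite ler_pdivlMr ?ler_pdivrMr ?mulr_gt0 ?ltr0n ?expn_gt0// mulNr.
  by rewrite sqr_div_pow2 -expRM_natr ler_expR; nra.
have {}ka : k%:R + 1 <= (2 ^ a)%:R :> R by rewrite natr1 ler_nat.
have e2 : (2 ^ a.+1)%:R = 2 * (2 ^ a)%:R :> R by rewrite expnS natrM.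
have pk : 0 <= pi * k%:R :> R by rewrite mulr_ge0 ?pi_ge0.
have pN : pi * (k%:R + 1) <= pi * (2 ^ a)%:R :> R by rewrite ler_pM2l ?pi_gt0.
have p2 := pi_ge2 R; case/andP: tp => t0 t1.
split; apply: key => //.
  by rewrite -[(Posz k)%:~R]/(k%:R : R) e2; lra.
have nk : (Negz k)%:~R = - (k%:R + 1) :> R by rewrite natr1.
by rewrite nk e2; lra.
Qed.

Lemma is_cvg_weight_series b t : 0 < b -> 0 <= t <= pi ->
  cvg (series (fun k => weight_term b t (Posz k) + weight_term b t (Negz k)) @ \oo).
Proof.
move=> b0 tp.
have r1 : `|expR (- (b / 4))| < 1 by rewrite ger0_norm ?expR_ge0// expR_lt1; lra.
apply: (series_le_cvg _ _ _ (is_cvg_geometric_series (a := 2) r1)) => k.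
- by rewrite addr_ge0 ?weight_term_ge0.
- by rewrite mulr_ge0// exprn_ge0 ?expR_ge0.
- by have [h1 h2] := weight_term_le k b0 tp; rewrite /geometric/=; lra.
Qed.

Lemma cvg_approx_sum b t : 0 < b -> 0 <= t <= pi ->
  \sum_(0 <= k < 2 ^ a) (approx_term b t a (Posz k) + approx_term b t a (Negz k))
    @[a --> \oo] --> villain_weight b t.
Proof.
move=> b0 tp; have cz := is_cvg_weight_series b0 tp.
pose r := expR (- (b / 4)).
have r1 : `|r| < 1 by rewrite ger0_norm ?expR_ge0// expR_lt1; lra.
pose v := geometric 2 r.
have vE k : v k = r ^+ k + r ^+ k by rewrite /v /geometric/=; lra.
set z := fun k => _ in cz.
have -> : villain_weight b t = lim (series z @ \oo).
  rewrite /villain_weight (@esum_int (weight_term b t) (lim (series z @ \oo)))//.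
  by move=> k; exact: weight_term_ge0.
apply: (@cvg_sum_dominated _ _ z v) => //.
- by move=> k; apply: cvgD; exact: cvg_cos_pow.
- have : \forall a \near \oo, b <= (approx_exp b a)%:R / (4 ^ a.+1)%:R.
    by have := cvgr_ge _ (cvg_approx_exp b0); apply; lra.
  apply: filterS => a cb k ka.
  have [h1 h2] := approx_term_le b0 tp cb ka.
  by rewrite ger0_norm ?vE ?addr_ge0 ?lerD// /approx_term exprM exprn_ge0 ?sqr_ge0.
- exact: is_cvg_geometric_series.
- move=> n; exists n => // a /= na.
  by rewrite (leq_trans na)// ltnW// ltn_expl.
Qed.

(** The power being even, each term is a power of cos^2 of a half-angle, that is of (1 + cos) / 2,
    and has period [2 ^ a.+1] in [k]. The window from -2^a to 2^a - 1 can thus be moved to a full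
    period starting at 0. *)
Lemma approx_sumE b t a :
  \sum_(0 <= k < 2 ^ a) (approx_term b t a (Posz k) + approx_term b t a (Negz k)) =
  \sum_(0 <= k < 2 ^ a.+1)
    ((2^-1 *: ('X + 1)) ^+ approx_exp b a).[cos ((t + 2 * pi * k%:R) / (2 ^ a.+1)%:R)].
Proof.
have l0 : (2 ^ a.+1)%:R != 0 :> R by rewrite pnatr_eq0 expn_eq0.
have per (k : int) : approx_term b t a (k + (2 ^ a.+1)%N) = approx_term b t a k.
  rewrite /approx_term !exprM; congr (_ ^+ _).
  have -> : (t + 2 * pi * (k + (2 ^ a.+1)%N)%:~R) / (2 * (2 ^ a.+1)%:R) =
    (t + 2 * pi * k%:~R) / (2 * (2 ^ a.+1)%:R) + pi.
    have d0 : 2 * (2 ^ a.+1)%:R != 0 :> R by rewrite mulf_neq0.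
    apply: (mulIf d0); rewrite divfK// [RHS]mulrDl divfK//.
    have -> : (k + (2 ^ a.+1)%N)%:~R = k%:~R + (2 ^ a.+1)%:R :> R by rewrite rmorphD.
    lra.
  by rewrite cosDpi sqrrN.
rewrite big_split /=.
have e2 : (2 ^ a.+1 = 2 ^ a + 2 ^ a)%N by rewrite expnS mul2n addnn.
rewrite [in RHS]e2 (big_cat_nat (leq0n (2 ^ a)) (leq_addr _ _))/=.
have step k : approx_term b t a (Posz k) =
    ((2^-1 *: ('X + 1)) ^+ approx_exp b a).[cos ((t + 2 * pi * k%:R) / (2 ^ a.+1)%:R)].
  rewrite /approx_term exprM !hornerE; congr (_ ^+ _).
  set y := _ / (2 * _).
  have -> : (t + 2 * pi * k%:R) / (2 ^ a.+1)%:R = y *+ 2.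
    by rewrite /y invfM -mulr_natr; lra.
  by rewrite cos_mulr2n; lra.
set h := (2 ^ a)%N.
have addh F : \sum_(h <= k < h + h) F k = \sum_(0 <= k < h) F (k + h)%N :> R.
  by rewrite -{1}[h]add0n big_addn addnK.
rewrite addh [X in _ + X = _]big_nat_rev /=; congr (_ + _).
  by apply: eq_bigr => k _; rewrite step e2.
rewrite !big_nat; apply: eq_bigr => k /andP[_ kh].
rewrite -/h add0n -e2 -step -per; congr (approx_term b t a _).
by rewrite e2 -/h NegzE; lia.
Qed.
End VillainWeight.

(** * Symmetries, positivity and the product formula of the weight *)

Section VillainWeightLimit.
Variable R : realType.
Implicit Types b t x : R.

Lemma esum_weight_bij b t t' (e : int -> int) : bijective e ->
  (forall k, weight_term b t' (e k) = weight_term b t k) ->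
  \esum_(k in [set: int]) (weight_term b t' k)%:E =
  \esum_(k in [set: int]) (weight_term b t k)%:E.
Proof.
move=> [f ef fe] ee.
rewrite (@reindex_esum _ _ _ setT setT e); first by apply: eq_esum => k _; rewrite ee.
split=> // [x y _ _ /(congr1 f)|x _]; first by rewrite !ef.
by exists (f x) => //; rewrite fe.
Qed.

Lemma esum_weightN b t :
  \esum_(k in [set: int]) (weight_term b (- t) k)%:E =
  \esum_(k in [set: int]) (weight_term b t k)%:E.
Proof.
apply: (@esum_weight_bij _ _ _ -%R); first by exists -%R => x; rewrite opprK.
move=> k; rewrite /weight_term; congr (expR (_ * _)).
by rewrite mulrNz mulrN -opprD sqrrN.
Qed.

Lemma esum_weight_shift b t (n : int) :
  \esum_(k in [set: int]) (weight_term b (t + 2 * pi * n%:~R) k)%:E =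
  \esum_(k in [set: int]) (weight_term b t k)%:E.
Proof.
apply: (@esum_weight_bij _ _ _ (fun k => k - n)).
  by exists (fun k => k + n) => k; rewrite ?addrK ?subrK.
move=> k; rewrite /weight_term; congr (expR (_ * _ ^+ 2)).
by rewrite rmorphB /=; lra.
Qed.

Lemma villain_weightN b t : villain_weight b (- t) = villain_weight b t.
Proof. by congr fine; exact: esum_weightN. Qed.

Lemma villain_weight_shift b t (n : int) :
  villain_weight b (t + 2 * pi * n%:~R) = villain_weight b t.
Proof. by congr fine; exact: esum_weight_shift. Qed.

Lemma cos_shift t (n : int) : cos (t + 2 * pi * n%:~R) = cos t.
Proof.
have per m (u : R) : cos (u + 2 * pi * m%:R) = cos u.
  rewrite [2 * pi]mulr_natl mulr_natr; exact: (periodicn (@cosD2pi R)).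
case: n => n; first exact: per.
by rewrite -(per n.+1) NegzE; congr cos; rewrite -addrA -mulrDr mulrNz addNr mulr0 addr0.
Qed.

Lemma reduce_angle t : exists n : int, - pi <= t + 2 * pi * n%:~R <= pi.
Proof.
have p0 := pi_gt0 R.
have p2 : 0 < 2 * pi :> R by rewrite mulr_gt0.
exists (- Num.floor (t / (2 * pi) + 2^-1)).
have /andP[] := real_floor_itv (num_real (t / (2 * pi) + 2^-1)).
set f := (Num.floor _)%:~R; rewrite rmorphN /= -/f => h1 h2.
rewrite rmorphD /= -/f in h2.
have tE : t = t / (2 * pi) * (2 * pi) by rewrite divfK// gt_eqF.
set c := t / _ in h1 h2 tE.
have h3 : 0 <= (c + 2^-1 - f) * (2 * pi) by rewrite mulr_ge0 ?(ltW p2)// subr_ge0.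
have h4 : 0 <= (f + 1 - (c + 2^-1)) * (2 * pi).
  by rewrite mulr_ge0 ?(ltW p2)// subr_ge0 ltW.
by apply/andP; split; lra.
Qed.

Lemma polyOver_nnegX (p : {poly R}) n :
  p \is a polyOver Num.nneg -> p ^+ n \is a polyOver Num.nneg.
Proof.
move=> /polyOverP pp; elim: n => [|n /polyOverP IH]; apply/polyOverP => i.
  by rewrite expr0 coef1 nnegrE ler0n.
by rewrite exprS coefM nnegrE sumr_ge0// => j _; rewrite mulr_ge0 -?nnegrE.
Qed.

Lemma villain_weight_cos_poly b : 0 < b -> exists q : nat -> {poly R},
  (forall a, q a \is a polyOver Num.nneg) /\
  forall t, (q a).[cos t] @[a --> \oo] --> villain_weight b t.
Proof.
move=> b0.
have /choice[q Hq] a : exists q : {poly R}, q \is a polyOver Num.nneg /\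
    forall t, \sum_(0 <= k < 2 ^ a) (approx_term b t a (Posz k) + approx_term b t a (Negz k)) = q.[cos t].
  have pp : ((2^-1 *: ('X + 1)) ^+ approx_exp b a : {poly R}) \is a polyOver Num.nneg.
    by apply: polyOver_nnegX; rewrite polyOverZ ?nnegrE// rpredD ?rpred1// polyOverX.
  by have [q qq qE] := sum_cos_poly a.+1 pp; exists q; split => // t; rewrite approx_sumE qE.
exists q; split=> [a|t]; first exact: (Hq a).1.
(* The weight and [cos] are both even and 2 pi-periodic, so the convergence on [0, pi] carries over
   to every [t]. *)
wlog tp : t / 0 <= t <= pi => [hw|]; last first.
  have := cvg_approx_sum b0 tp; apply: cvg_trans; apply: near_eq_cvg; apply: nearW => a.
  by rewrite (Hq a).2.
have [n /andP[n1 n2]] := reduce_angle t.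
rewrite -(villain_weight_shift b t n).
under eq_fun do rewrite -(cos_shift t n).
set s := t + _ in n1 n2 *.
have [s0|s0] := leP 0 s; first by apply: hw; rewrite s0.
rewrite -villain_weightN; under eq_fun do rewrite -cosN.
by apply: hw; lra.
Qed.

Lemma esum_weight b t : 0 < b ->
  \esum_(m in [set: int]) (weight_term b t m)%:E = (villain_weight b t)%:E.
Proof.
move=> b0; rewrite /villain_weight fineK//.
wlog tp : t / 0 <= t <= pi => [hw|]; last first.
  by rewrite (esum_int _ (is_cvg_weight_series b0 tp))// => k; exact: weight_term_ge0.
have [n /andP[n1 n2]] := reduce_angle t.
rewrite -(esum_weight_shift b t n).
set s := t + _ in n1 n2 *.
have [s0|s0] := leP 0 s; first by apply: hw; rewrite s0.
by rewrite -esum_weightN; apply: hw; lra.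
Qed.

Lemma villain_weight_ge b t : 0 < b -> expR (- (b / 2) * t ^+ 2) <= villain_weight b t.
Proof.
move=> b0; rewrite -lee_fin -esum_weight//.
have -> : (expR (- (b / 2) * t ^+ 2))%:E = \esum_(k in [set 0]) (weight_term b t k)%:E.
  by rewrite esum_set1 ?lee_fin ?weight_term_ge0// /weight_term mulr0 addr0.
rewrite esum_mkcond; apply: le_esum => k _; case: ifP => // _.
by rewrite lee_fin weight_term_ge0.
Qed.

Lemma villain_weight_gt0 b t : 0 < b -> 0 < villain_weight b t.
Proof. by move=> b0; apply: lt_le_trans (villain_weight_ge t b0); exact: expR_gt0. Qed.

Lemma esum_int_mull (c : R) (f : int -> \bar R) : 0 <= c -> (forall k, 0 <= f k)%E ->
  (\esum_(m in [set: int]) (c%:E * f m) = c%:E * (\esum_(m in [set: int]) f m))%E.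
Proof.
move=> c0 f0; rewrite !esum_intE// => [|k]; last by rewrite mule_ge0.
by rewrite !nneseriesZl// ge0_muleDr// nneseries_ge0.
Qed.

Lemma esum_int_mul (f g : int -> R) (Z : R) : (forall k, 0 <= f k) -> (forall k, 0 <= g k) ->
  \esum_(m in [set: int]) (g m)%:E = Z%:E ->
  ((\esum_(m in [set: int]) (f m)%:E) * (\esum_(m in [set: int]) (g m)%:E) =
   \esum_(p in [set: int * int]) (f p.1 * g p.2)%:E)%E.
Proof.
move=> f0 g0 gZ.
have Z0 : 0 <= Z by rewrite -lee_fin -gZ; apply: esum_ge0 => k _; rewrite lee_fin.
transitivity (\esum_(m in [set: int]) \esum_(n in [set: int]) (f m * g n)%:E).
  rewrite gZ muleC -esum_int_mull//; apply: eq_esum => m _.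
  by rewrite muleC -gZ -esum_int_mull.
rewrite esum_esum; last by move=> i j _ _; rewrite lee_fin mulr_ge0.
by congr esum; apply/seteqP; split.
Qed.

(* Rotate the pair of winding numbers (m, n) to ((m + n) / 2, (m - n) / 2),
   separating the two parities of m + n. *)
Lemma villain_weight_mul b t t' : 0 < b ->
  villain_weight b t * villain_weight b t' =
  villain_weight (2 * b) ((t + t') / 2) * villain_weight (2 * b) ((t - t') / 2) +
  villain_weight (2 * b) ((t + t') / 2 + pi) * villain_weight (2 * b) ((t - t') / 2 + pi).
Proof.
move=> b0; have b20 : 0 < 2 * b by rewrite mulr_gt0.
apply: EFin_inj; rewrite EFinD !EFinM -!esum_weight//.
rewrite !(esum_int_mul _ _ (esum_weight _ _))//; try by move=> k; exact: weight_term_ge0.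
pose e0 (p : int * int) := (p.1 + p.2, p.1 - p.2).
(* On the image of [e1] the half sum and half difference of the winding numbers are [i + 1/2] and
   [j + 1/2]; the extra halves become the two shifts by pi. *)
pose e1 (p : int * int) := (p.1 + p.2 + 1, p.1 - p.2).
rewrite (esumID (range e0)) => [|p _]; last by rewrite lee_fin mulr_ge0 ?weight_term_ge0.
rewrite !setTI.
have -> : ~` range e0 = range e1.
  apply/seteqP; split => [[m n] /= mn | _ [[i j] _ <-] [[i' j'] _]]; last first.
    by rewrite /e0 /e1 /= => -[]; lia.
  have [i [mE|mE]] : exists i : int, m + n = 2 * i \/ m + n = 2 * i + 1.
    by exists ((m + n) %/ 2)%Z; lia.
  - by exfalso; apply: mn; exists (i, m - i) => //; rewrite /e0 /=; congr pair; lia.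
  - by exists (i, m - i - 1) => //; rewrite /e1 /=; congr pair; lia.
rewrite !esum_image; last 2 first.
- by move=> [i j] [i' j'] _ _ [] /= h1 h2; congr pair; lia.
- by move=> [i j] [i' j'] _ _ [] /= h1 h2; congr pair; lia.
congr (_ + _)%E; apply: eq_esum => -[i j] _; congr EFin; rewrite /weight_term /= -!expRD;
  congr expR; rewrite !rmorphD ?rmorphB ?rmorphN /=; lra.
Qed.

End VillainWeightLimit.

(** * Lebesgue measure of boxes and iterated integration *)

Section LebesgueTuple.
Variable R : realType.
Local Notation lambda := (@lebesgue_measure R).

Definition box n (a b : R) : set (n.-tuple R) :=
  [set theta | forall i, a <= tnth theta i < b].
Arguments box n a b : clear implicits.

Lemma measurable_box n a b : measurable (box n a b).
Proof.
have -> : box n a b = \bigcap_(i : 'I_n) ((fun t => tnth t i) @^-1` `[a, b[).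
  apply/seteqP; split => t /= h.
    by move=> i _; rewrite /= in_itv/=; exact: h.
  by move=> i; have := h i I; rewrite /= in_itv/=.
apply: fin_bigcap_measurable; first exact: finite_finset.
by move=> i _; rewrite -[X in measurable X]setTI; apply: measurable_tnth.
Qed.

Lemma preimage_cons_box n a b :
  @Defs.cons_tuple R n @^-1` box n.+1 a b = box n a b `*` `[a, b[%classic.
Proof.
apply/seteqP; split => -[t x] /=.
  move=> h; split => /=; last by have := h ord0; rewrite in_itv/= (tnth_nth 0).
  by move=> i; have := h (lift ord0 i); rewrite tnthS.
move=> [/= ht]; rewrite in_itv/= => hx i.
have [j ->|->] := unliftP ord0 i; first by rewrite tnthS.
by rewrite (tnth_nth 0).
Qed.

Lemma lebesgue_measure_itvco a b : a <= b -> lambda `[a, b[%classic = (b - a)%:E.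
Proof.
rewrite lebesgue_measure_itv/= lte_fin le_eqVlt => /predU1P[->|->]; last by rewrite EFinB.
by rewrite ltxx subrr.
Qed.

Lemma lebesgue_tuple_box n a b : a <= b ->
  lebesgue_tuple R n (box n a b) = ((b - a) ^+ n)%:E.
Proof.
move=> ab; elim: n => [|n IH].
  by rewrite /= diracE mem_set// => -[].
rewrite [LHS]/= /lebesgue_cons /pushforward preimage_cons_box.
rewrite product_measure1E//; last exact: measurable_box.
rewrite exprSr EFinM IH; congr (_ * _)%E; exact: lebesgue_measure_itvco.
Qed.

Lemma sigma_finite_lebesgue_tuple n : sigma_finite setT (lebesgue_tuple R n).
Proof.
exists (fun k => box n (- k%:R) k%:R) => [|k]; last first.
  split; first exact: measurable_box.
  by rewrite lebesgue_tuple_box ?ltry// lerNl (le_trans (_ : _ <= 0)) ?oppr_le0.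
apply/seteqP; split => // t _.
pose M := \sum_(i < n) `|tnth t i|.
exists (Num.truncn M).+1 => //= i.
have : `|tnth t i| < (Num.truncn M).+1%:R.
  apply: le_lt_trans (truncnS_gt M).
  by rewrite /M (bigD1 i)//= lerDl sumr_ge0.
by rewrite ltr_norml => /andP[h1 h2]; rewrite h2 ltW.
Qed.

(* lebesgue_tuple with its sigma-finiteness attached *)
Definition lebesgue_box n : set (n.-tuple R) -> \bar R := lebesgue_tuple R n.

HB.instance Definition _ n := isMeasure.Build _ _ R (@lebesgue_box n)
  (measure0 (lebesgue_tuple R n)) (measure_ge0 (lebesgue_tuple R n))
  (@measure_semi_sigma_additive _ _ _ (lebesgue_tuple R n)).

HB.instance Definition _ n := Measure_isSigmaFinite.Build _ _ R (@lebesgue_box n)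
  (@sigma_finite_lebesgue_tuple n).

(** The measure on n+1 coordinates is a pushforward of a product, so the integral is pulled back
    along [cons_tuple] first. Fubini then applies to the integrand extended by zero outside the box,
    integrable because it is bounded on a set of finite measure. *)
Lemma lebesgue_tuple_fubini n a b (g : n.+1.-tuple R -> R) (C : R) :
  a <= b -> measurable_fun setT g -> (forall t, box n.+1 a b t -> `|g t| <= C) ->
  (\int[lebesgue_tuple R n.+1]_(t in box n.+1 a b) (g t)%:E =
   \int[lebesgue_tuple R n]_(t in box n a b) \int[lambda]_(x in `[a, b[) (g (Defs.cons_tuple (t, x)))%:E)%E.
Proof.
move=> ab mg gC.
pose mu := lebesgue_tuple R n.
pose mu' : {sigma_finite_measure set (n.-tuple R) -> \bar R} := @lebesgue_box n.
pose nu : {measure set (n.-tuple R * measurableTypeR R) -> \bar R} := (mu \x lambda)%E.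
have mg' : measurable_fun [set: n.+1.-tuple R] (EFin \o g) by exact/measurable_EFinP.
have mB := @measurable_box n a b.
have mI : measurable (`[a, b[%classic : set R) by exact: measurable_itv.
have mBI : measurable (box n a b `*` `[a, b[%classic) by exact: measurableX.
have mphi : measurable_fun [set: n.-tuple R * measurableTypeR R] (@Defs.cons_tuple R n).
  exact: measurable_cons_tuple.
have mgc0 : measurable_fun [set: n.-tuple R * measurableTypeR R] (g \o @Defs.cons_tuple R n).
  exact: (measurableT_comp mg mphi).
have mgc : measurable_fun [set: n.-tuple R * measurableTypeR R] (EFin \o (g \o @Defs.cons_tuple R n)).
  exact/measurable_EFinP.
have intf : nu.-integrable (@Defs.cons_tuple R n @^-1` box n.+1 a b)
    (EFin \o (g \o @Defs.cons_tuple R n)).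
  rewrite preimage_cons_box.
  apply: (@measurable_bounded_integrable _ _ _ nu (g \o @Defs.cons_tuple R n)) => //.
  - have E : (nu (box n a b `*` `[a, b[%classic) = ((b - a) ^+ n * (b - a))%:E)%E.
      rewrite EFinM -(lebesgue_tuple_box n ab) -(lebesgue_measure_itvco ab).
      exact: product_measure1E.
    exact: (eq_ind_r (fun z => (z < +oo)%E) (ltry _) E).
  - exact: measurable_funTS.
  - exists C; split; first exact: num_real.
    move=> x Cx z; rewrite -preimage_cons_box => /gC h.
    exact: le_trans (ltW Cx).
rewrite [LHS](@integral_pushforward _ _ _ _ _ _ mphi nu
  (box n.+1 a b) (EFin \o g) mg' intf (@measurable_box _ a b)).
rewrite preimage_cons_box in intf *.
set F := EFin \o (g \o @Defs.cons_tuple R n) in intf mgc *.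
set D := _ `*` _ in intf mBI *.
have intf' : nu.-integrable setT (F \_ D).
  by apply/integrable_restrict => //; rewrite setTI.
rewrite integral_mkcond [LHS](esym (@integral12_prod_meas1 _ _ _ _ R mu' lambda (F \_ D) intf')).
rewrite [RHS]integral_mkcond; apply: eq_integral => t _.
rewrite /fubini_F /patch; have [tB|tB] := boolP (t \in box n a b); last first.
  apply: integral0_eq => x _; rewrite /patch; case: ifPn => //.
  by rewrite inE => -[/= tB' _]; case/negP: tB; rewrite inE.
rewrite [RHS]integral_mkcond; apply: eq_integral => x _; rewrite /patch.
have -> // : ((t, x) \in D) = (x \in `[a, b[%classic).
by rewrite /D in_setX tB.
Qed.
End LebesgueTuple.
Arguments box {R} n a b.

(** * Integration over the torus and orthogonality of characters *)

Section TorusIntegral.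
Variable R : realType.
Local Notation lambda := (@lebesgue_measure R).

Local Notation period := (`[(- pi : R)%R, pi%R[%classic).

Lemma sin_shift (x : R) (n : int) : sin (x + 2 * pi * n%:~R) = sin x.
Proof. by rewrite -!cosBpihalf addrAC cos_shift. Qed.

Lemma integral_cos_period (k : int) (c : R) :
  (\int[lambda]_(x in period) (cos (k%:~R * x + c))%:E = (2 * pi * (k == 0)%:R * cos c)%:E)%E.
Proof.
have p0 := pi_gt0 R; have pN : - pi < pi :> R by rewrite gtrN.
have cc : continuous (fun x : R => cos (k%:~R * x + c)).
  move=> x; apply: continuous_comp; last exact: continuous_cos.
  apply: cvgD; last exact: cvg_cst.
  by apply: cvgM; [exact: cvg_cst | exact: cvg_id].
rewrite integral_itv_bndo_bndc; last first.
  by apply/measurable_EFinP; apply: measurable_funTS; exact: continuous_measurable_fun.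
have [->|k0] := eqVneq k 0.
  under eq_integral do rewrite mul0r add0r.
  rewrite integral_cst//= lebesgue_measure_itv/= lte_fin pN -EFinB -EFinM.
  by congr EFin; lra.
pose F x := sin (k%:~R * x + c) / k%:~R : R.
have kR : k%:~R != 0 :> R by rewrite intr_eq0.
have dF (x : R) : is_derive x (1 : R) F (cos (k%:~R * x + c)).
  apply: is_derive_eq; rewrite /GRing.scale/= !(mulr1, mulr0, addr0, add0r, mul0r).
  by rewrite mulrC mulfK.
rewrite (@continuous_FTC2 _ _ F)//.
- rewrite /F -EFinB -mulrBl (_ : k%:~R * pi + c = k%:~R * - pi + c + 2 * pi * k%:~R); last by lra.
  by rewrite sin_shift subrr mul0r mulr0 mul0r.
- exact: continuous_subspaceT.
- split.
  + by move=> x _; exact: ex_derive.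
  + apply: cvg_at_right_filter; apply: differentiable_continuous.
    by apply/derivable1_diffP; exact: ex_derive.
  + apply: cvg_at_left_filter; apply: differentiable_continuous.
    by apply/derivable1_diffP; exact: ex_derive.
- by move=> x _; rewrite derive1E (@derive_val _ _ _ _ _ _ _ (dF x)).
Qed.

Definition torus n : set (n.-tuple R) := box n (- pi) pi.
Arguments torus : clear implicits.

Definition torus_int n (f : n.-tuple R -> R) : R :=
  \int[lebesgue_tuple R n]_(t in torus n) f t.

Definition bounded_measurable n (f : n.-tuple R -> R) :=
  measurable_fun setT f /\ exists C, forall t, `|f t| <= C.

Lemma measurable_torus n : measurable (torus n).
Proof. exact: measurable_box. Qed.

Let Npi_le_pi : - pi <= pi :> R.
Proof. by rewrite (le_trans (_ : _ <= 0)) ?oppr_le0 ?pi_ge0. Qed.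

Lemma torus_measure n : lebesgue_tuple R n (torus n) = ((2 * pi) ^+ n)%:E.
Proof. by rewrite lebesgue_tuple_box// opprK -mulr2n mulr_natl. Qed.

Lemma bounded_measurable_integrable n (f : n.-tuple R -> R) : bounded_measurable f ->
  (lebesgue_tuple R n).-integrable (torus n) (EFin \o f).
Proof.
move=> [mf [C fC]]; apply: measurable_bounded_integrable.
- exact: measurable_torus.
- by rewrite [X in (X < _)%E]torus_measure ltry.
- exact: measurable_funTS.
- by exists C; split; [exact: num_real | move=> x Cx t _; exact: le_trans (ltW Cx)].
Qed.

Lemma bounded_measurable_cst n (c : R) : bounded_measurable (fun _ : n.-tuple R => c).
Proof. by split; [exact: measurable_cst | exists `|c|]. Qed.

Lemma bounded_measurableD n (f g : n.-tuple R -> R) :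
  bounded_measurable f -> bounded_measurable g -> bounded_measurable (fun t => f t + g t).
Proof.
move=> [mf [C fC]] [mg [D gD]]; split; first exact: measurable_funD.
by exists (C + D) => t; apply: le_trans (ler_normD _ _) _; exact: lerD.
Qed.

Lemma bounded_measurableM n (f g : n.-tuple R -> R) :
  bounded_measurable f -> bounded_measurable g -> bounded_measurable (fun t => f t * g t).
Proof.
move=> [mf [C fC]] [mg [D gD]]; split; first exact: measurable_funM.
by exists (C * D) => t; rewrite normrM ler_pM.
Qed.

Lemma bounded_measurable_prod n (I : Type) (r : seq I) (f : I -> n.-tuple R -> R) :
  (forall i, bounded_measurable (f i)) ->
  bounded_measurable (fun t => \prod_(i <- r) f i t).
Proof.
move=> fi; elim: r => [|i r IH].
  by under eq_fun do rewrite big_nil; exact: bounded_measurable_cst.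
by under eq_fun do rewrite big_cons; exact: bounded_measurableM.
Qed.

Lemma bounded_measurable_cos n (f : n.-tuple R -> R) :
  measurable_fun setT f -> bounded_measurable (fun t => cos (f t)).
Proof.
move=> mf; split; last by exists 1 => t; exact: cos_max.
by apply: measurableT_comp => //; apply: continuous_measurable_fun; exact: continuous_cos.
Qed.

Lemma torus_int_ext n (f g : n.-tuple R -> R) : (forall t, torus n t -> f t = g t) ->
  torus_int f = torus_int g.
Proof. by move=> fg; apply: eq_Rintegral => t; rewrite inE => /fg. Qed.

Lemma torus_int_cst n (c : R) : torus_int (fun _ : n.-tuple R => c) = (2 * pi) ^+ n * c.
Proof.
transitivity (c * fine (lebesgue_tuple R n (torus n))).
  exact: (Rintegral_cst _ (@measurable_torus n)).
by have -> := torus_measure n; rewrite mulrC.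
Qed.

Lemma torus_intD n (f g : n.-tuple R -> R) :
  bounded_measurable f -> bounded_measurable g ->
  torus_int (fun t => f t + g t) = torus_int f + torus_int g.
Proof.
move=> bf bg; apply: RintegralD; first exact: measurable_torus.
- exact: bounded_measurable_integrable.
- exact: bounded_measurable_integrable.
Qed.

Lemma torus_intZ n (c : R) (f : n.-tuple R -> R) : bounded_measurable f ->
  torus_int (fun t => c * f t) = c * torus_int f.
Proof.
move=> bf; apply: RintegralZl; first exact: measurable_torus.
exact: bounded_measurable_integrable.
Qed.

Lemma le_torus_int n (f g : n.-tuple R -> R) :
  bounded_measurable f -> bounded_measurable g -> (forall t, torus n t -> f t <= g t) ->
  torus_int f <= torus_int g.
Proof.
move=> bf bg fg; apply: le_Rintegral => //; first exact: measurable_torus.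
- exact: bounded_measurable_integrable.
- exact: bounded_measurable_integrable.
Qed.

Lemma torus_int_fubini n (g : n.+1.-tuple R -> R) (h : n.-tuple R -> R) :
  bounded_measurable g ->
  (forall t, \int[lambda]_(x in period) (g (Defs.cons_tuple (t, x)))%:E = (h t)%:E)%E ->
  torus_int g = torus_int h.
Proof.
move=> [mg [C gC]] gh; rewrite /torus_int /Rintegral; congr fine.
rewrite (@lebesgue_tuple_fubini _ _ _ _ _ C)//.
by apply: eq_integral => t _; rewrite gh.
Qed.

Lemma measurable_linear n (p : 'I_n -> R) (c : R) :
  measurable_fun setT (fun t : n.-tuple R => \sum_(i < n) p i * tnth t i + c).
Proof.
apply: measurable_funD; last exact: measurable_cst.
apply: measurable_sum => i; apply: measurable_funM; first exact: measurable_cst.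
exact: measurable_tnth.
Qed.

(** Orthogonality of characters. The phase [c] allows each coordinate to be integrated with the
    remaining sum as a constant, so that cosines alone suffice. *)
Lemma torus_int_cos n (p : 'I_n -> int) (c : R) :
  torus_int (fun t : n.-tuple R => cos (\sum_(i < n) (p i)%:~R * tnth t i + c)) =
  (2 * pi) ^+ n * [forall i, p i == 0]%:R * cos c.
Proof.
elim: n p c => [|n IH] p c.
  under [LHS]torus_int_ext => t _ do rewrite big_ord0 add0r.
  rewrite torus_int_cst expr0 !mul1r.
  have -> : [forall i, p i == 0] by apply/forallP => -[].
  by rewrite mul1r.
pose q i := p (lift ord0 i).
rewrite (@torus_int_fubini n _ (fun t => 2 * pi * (p ord0 == 0)%:R *
  cos (\sum_(i < n) (q i)%:~R * tnth t i + c))).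
- rewrite torus_intZ; last by apply: bounded_measurable_cos; exact: measurable_linear.
  rewrite IH exprS.
  have -> : [forall i, p i == 0] = (p ord0 == 0) && [forall i, q i == 0].
    apply/forallP/andP => [h|[h0 /forallP h] i]; first by split; [exact: h | apply/forallP => i; exact: h].
    by have [j ->|->] := unliftP ord0 i; [exact: h | exact: h0].
  rewrite -mulnb natrM; lra.
- by apply: bounded_measurable_cos; exact: measurable_linear.
- move=> t; rewrite -integral_cos_period; apply: eq_integral => x _; congr (cos _)%:E.
  rewrite big_ord_recl /= addrA; congr (_ * _ + _ + _).
  by apply: eq_bigr => i _; rewrite tnthS.
Qed.

Lemma cvg_torus_int n (f_ : nat -> n.-tuple R -> R) (f : n.-tuple R -> R) (C : R) :
  (forall a, measurable_fun setT (f_ a)) -> measurable_fun setT f ->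
  (forall a t, `|f_ a t| <= C) ->
  (forall t, f_ a t @[a --> \oo] --> f t) ->
  torus_int (f_ a) @[a --> \oo] --> torus_int f.
Proof.
move=> mf_ mf fC ff.
have mT := @measurable_torus n.
have := @dominated_convergence _ _ _ (lebesgue_tuple R n) (torus n) mT
  (fun a t => (f_ a t)%:E) (fun t => (f t)%:E) (fun=> C%:E).
case.
- by move=> a; apply/measurable_EFinP; exact: measurable_funTS.
- by apply/measurable_EFinP; exact: measurable_funTS.
- by apply: aeW => t _; apply: cvg_EFin; [exact: nearW | exact: ff].
- by apply: bounded_measurable_integrable; exact: bounded_measurable_cst.
- by apply: aeW => t a _; rewrite lee_fin.
move=> intf _ cv.
apply: fine_cvg; rewrite /torus_int /Rintegral fineK; first exact: cv.
by apply: integrable_fin_num.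
Qed.
End TorusIntegral.
Arguments torus {R} n.

(** * Integrals over a pair of tori as products of two counts *)

Section PairIntegral.
Variables (R : realType) (V : choiceType).
Implicit Types (s : seq V) (f g : V -> R) (p P Q : V -> int) (e : V * V) (L : seq (V * V)).

Definition angle_of s (t : (size s).-tuple R) : V -> R := fun v => nth 0 t (index v s).

Definition pairing s p f : R := \sum_(v <- s) (p v)%:~R * f v.

Lemma measurable_angle_of s v : measurable_fun setT (fun t : (size s).-tuple R => angle_of t v).
Proof.
have [vs|vs] := boolP (v \in s).
  have ivs : (index v s < size s)%N by rewrite index_mem.
  have -> : (fun t : (size s).-tuple R => angle_of t v) = (fun t => tnth t (Ordinal ivs)).
    by apply/funext => t; rewrite /angle_of (tnth_nth 0).
  exact: measurable_tnth.
have -> : (fun t : (size s).-tuple R => angle_of t v) = (fun=> 0).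
  by apply/funext => t; rewrite /angle_of nth_default// size_tuple leqNgt index_mem.
exact: measurable_cst.
Qed.

Lemma measurable_pairing s s' p c :
  measurable_fun setT (fun t : (size s).-tuple R => pairing s' p (angle_of t) + c).
Proof.
apply: measurable_funD; last exact: measurable_cst.
apply: measurable_sum => v; apply: measurable_funM; first exact: measurable_cst.
exact: measurable_angle_of.
Qed.

Lemma torus_int_pairing s p c : uniq s ->
  torus_int (fun t : (size s).-tuple R => cos (pairing s p (angle_of t) + c)) =
  (2 * pi) ^+ size s * (all (fun v => p v == 0) s)%:R * cos c.
Proof.
move=> us.
have -> : all (fun v => p v == 0) s = [forall i, p (tnth (in_tuple s) i) == 0].
  apply/allP/forallP => [h i|h v vs]; first exact/h/mem_tnth.
  have /tnthP[i ->] : v \in in_tuple s by [].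
  exact: h.
rewrite -torus_int_cos; apply: torus_int_ext => t _; congr (cos (_ + _)).
rewrite /pairing big_tnth; apply: eq_bigr => i _; congr (_ * _).
by rewrite /angle_of (tnth_nth 0) [tnth _ i](tnth_nth (tnth (in_tuple s) i)) index_uniq.
Qed.

Lemma pairingD s p P f : pairing s (p + P) f = pairing s p f + pairing s P f.
Proof. by rewrite /pairing -big_split; apply: eq_bigr => v _; rewrite /= fun_applyE rmorphD mulrDl. Qed.

Lemma pairingN s p f : pairing s (- p) f = - pairing s p f.
Proof.
rewrite /pairing -sumrN; apply: eq_bigr => v _.
by rewrite fun_applyE rmorphN mulNr.
Qed.

Lemma pairing_dlt s u f : uniq s -> u \in s -> pairing s (dlt u) f = f u.
Proof.
move=> us uin; rewrite /pairing (bigD1_seq u)//= dltxx mul1r big1_seq ?addr0// => v /andP[vu _].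
by rewrite /dlt (negPf vu) mul0r.
Qed.

Lemma pairing_bdry s e f : uniq s -> e.1 \in s -> e.2 \in s ->
  pairing s (bdry e) f = f e.1 - f e.2.
Proof. by move=> us e1 e2; rewrite /bdry pairingD pairingN !pairing_dlt. Qed.

Lemma pairing_sub s s' p f : uniq s -> uniq s' -> {subset s' <= s} ->
  (forall v, v \notin s' -> p v = 0) -> pairing s p f = pairing s' p f.
Proof.
move=> us us' ss out; rewrite /pairing (bigID (fun v => v \in s')) /= [X in _ + X]big1 ?addr0; last first.
  by move=> v /out ->; rewrite mul0r.
rewrite -big_filter; apply: perm_big; apply: uniq_perm => //; first exact: filter_uniq.
by move=> v; rewrite mem_filter; case: (boolP (v \in s')) => //= vs; rewrite ss.
Qed.

Definition edges_in s L := all (fun e => (e.1 \in s) && (e.2 \in s)) L.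

Definition multicos L f : R := \prod_(e <- L) (2 * cos (f e.1 - f e.2)).

Section TwoTori.
Variables s s' : seq V.
Hypotheses (us : uniq s) (us' : uniq s') (ss : {subset s' <= s}).

(* The two regularity clauses make such iterated integrals linear in h. *)
Definition pair_integral (h : (V -> R) -> (V -> R) -> R) (c : R) :=
  [/\ forall t : (size s).-tuple R,
        bounded_measurable (fun t' : (size s').-tuple R => h (angle_of t) (angle_of t')),
      bounded_measurable (fun t : (size s).-tuple R =>
        torus_int (fun t' : (size s').-tuple R => h (angle_of t) (angle_of t'))) &
      torus_int (fun t : (size s).-tuple R =>
        torus_int (fun t' : (size s').-tuple R => h (angle_of t) (angle_of t'))) =
      c * (2 * pi) ^+ (size s + size s')].

Lemma pair_integral_ext h h' c :
  (forall (t : (size s).-tuple R) (t' : (size s').-tuple R),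
    h' (angle_of t) (angle_of t') = h (angle_of t) (angle_of t')) ->
  pair_integral h c -> pair_integral h' c.
Proof.
move=> hh [h1 h2 h3].
have E : (fun t : (size s).-tuple R =>
        torus_int (fun t' : (size s').-tuple R => h' (angle_of t) (angle_of t'))) =
  (fun t : (size s).-tuple R =>
        torus_int (fun t' : (size s').-tuple R => h (angle_of t) (angle_of t'))).
  by apply/funext => t; congr torus_int; apply/funext => t'; rewrite hh.
split; rewrite ?E// => t.
by rewrite (_ : (fun t' => _) = (fun t' : (size s').-tuple R => h (angle_of t) (angle_of t')))//;
  apply/funext => t'.
Qed.

Lemma pair_integralD h h' c c' : pair_integral h c -> pair_integral h' c' ->
  pair_integral (fun f f' => h f f' + h' f f') (c + c').
Proof.
move=> [h1 h2 h3] [h1' h2' h3'].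
have E : (fun t : (size s).-tuple R =>
     torus_int (fun t' : (size s').-tuple R => h (angle_of t) (angle_of t') + h' (angle_of t) (angle_of t'))) =
   (fun t : (size s).-tuple R =>
     torus_int (fun t' : (size s').-tuple R => h (angle_of t) (angle_of t')) +
     torus_int (fun t' : (size s').-tuple R => h' (angle_of t) (angle_of t'))).
  by apply/funext => t; rewrite torus_intD//.
split.
- by move=> t; exact: bounded_measurableD.
- by rewrite E; exact: bounded_measurableD.
- by rewrite E (torus_intD h2 h2') h3 h3' [RHS]mulrDl.
Qed.

Lemma pair_integralZ h c a : pair_integral h c ->
  pair_integral (fun f f' => a * h f f') (a * c).
Proof.
move=> [h1 h2 h3].
have E : (fun t : (size s).-tuple R =>
     torus_int (fun t' : (size s').-tuple R => a * h (angle_of t) (angle_of t'))) =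
   (fun t : (size s).-tuple R =>
     a * torus_int (fun t' : (size s').-tuple R => h (angle_of t) (angle_of t'))).
  by apply/funext => t; rewrite torus_intZ.
split.
- by move=> t; apply: bounded_measurableM => //; exact: bounded_measurable_cst.
- by rewrite E; apply: bounded_measurableM => //; exact: bounded_measurable_cst.
- by rewrite E (torus_intZ _ h2) h3 mulrA.
Qed.

Lemma pair_integral0 : pair_integral (fun _ _ => 0) 0.
Proof.
split=> [t||]; first exact: bounded_measurable_cst.
- by under eq_fun do rewrite torus_int_cst mulr0; exact: bounded_measurable_cst.
- by under eq_fun do rewrite torus_int_cst mulr0; rewrite torus_int_cst mulr0 mul0r.
Qed.

Lemma pair_integral_sum (I : eqType) (r : seq I) (h : I -> (V -> R) -> (V -> R) -> R) (c : I -> R) :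
  (forall i, i \in r -> pair_integral (h i) (c i)) ->
  pair_integral (fun f f' => \sum_(i <- r) h i f f') (\sum_(i <- r) c i).
Proof.
elim: r => [|i r IH] hr.
  rewrite big_nil; apply: pair_integral_ext pair_integral0 => t t'.
  by rewrite big_nil.
rewrite big_cons; apply: (@pair_integral_ext (fun f f' => h i f f' + \sum_(j <- r) h j f f')).
  by move=> t t'; rewrite big_cons.
apply: pair_integralD; first by apply: hr; rewrite mem_head.
by apply: IH => j jr; apply: hr; rewrite inE jr orbT.
Qed.

Lemma pair_integral_cos p p' :
  pair_integral (fun f f' => cos (pairing s p f + pairing s' p' f'))
    ((all (fun v => p v == 0) s)%:R * (all (fun v => p' v == 0) s')%:R).
Proof.
have E : (fun t : (size s).-tuple R => torus_int (fun t' : (size s').-tuple R =>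
      cos (pairing s p (angle_of t) + pairing s' p' (angle_of t')))) =
   (fun t : (size s).-tuple R => (2 * pi) ^+ size s' * (all (fun v => p' v == 0) s')%:R *
      cos (pairing s p (angle_of t) + 0)).
  apply/funext => t; rewrite addr0 -torus_int_pairing//.
  by apply: torus_int_ext => t' _; rewrite addrC.
have B : bounded_measurable (fun t : (size s).-tuple R => cos (pairing s p (angle_of t) + 0)).
  by apply: bounded_measurable_cos; exact: measurable_pairing.
split.
- move=> t; apply: bounded_measurable_cos; under eq_fun do rewrite addrC.
  exact: measurable_pairing.
- by rewrite E; apply: bounded_measurableM => //; exact: bounded_measurable_cst.
- rewrite E torus_intZ// torus_int_pairing// cos0 exprD; lra.
Qed.

Definition half_sum f f' : V -> R := fun v => (f v + f' v) / 2.
Definition half_diff f f' : V -> R := fun v => (f v - f' v) / 2.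

Definition phase P Q f f' := pairing s P (half_sum f f') + pairing s Q (half_diff f f').

Definition boundary L : V -> int := \sum_(e <- L) bdry e.

Lemma boundary_cons e L v : boundary (e :: L) v = bdry e v + boundary L v.
Proof. by rewrite /boundary big_cons. Qed.

Lemma bdry_out e v : e.1 \in s' -> e.2 \in s' -> v \notin s' -> bdry e v = 0.
Proof.
move=> e1 e2 vs; rewrite /bdry !fun_applyE /dlt.
have /negPf -> : v != e.1 by apply: contraNneq vs => ->.
by have /negPf -> : v != e.2 by apply: contraNneq vs => ->.
Qed.

(** In the original angles the phase has coefficients [k] on [f] and [k - Q] on [f'], integers
    because [P + Q] is even. Outside [s'], where [f'] has no coordinate to integrate, [P = Q] makes
    the second one vanish. Both coefficients are zero exactly when [P] and [Q] are. *)
Lemma pair_integral_phase P Q (k : V -> int) :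
  (forall v, P v + Q v = 2 * k v) -> (forall v, v \notin s' -> P v = Q v) ->
  pair_integral (fun f f' => cos (phase P Q f f'))
    ((all (fun v => P v == 0) s)%:R * (all (fun v => Q v == 0) s)%:R).
Proof.
move=> PQ out.
have -> : (all (fun v => P v == 0) s)%:R * (all (fun v => Q v == 0) s)%:R =
   (all (fun v => k v == 0) s)%:R * (all (fun v => (k - Q) v == 0) s')%:R :> R.
  rewrite -!natrM !mulnb; congr (nat_of_bool _)%:R.
  apply/andP/andP => -[/allP h1 /allP h2].
    split; apply/allP => v vs; last first.
      have vss := ss vs.
      by move: (PQ v) (eqP (h1 _ vss)) (eqP (h2 _ vss)); rewrite !fun_applyE; lia.
    by move: (PQ v) (eqP (h1 _ vs)) (eqP (h2 _ vs)); lia.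
  have hh v : v \in s -> P v = 0 /\ Q v = 0.
    move=> vs; have := PQ v; have /eqP := h1 _ vs.
    have [vs'|vs'] := boolP (v \in s'); last by have := out _ vs'; lia.
    by have /eqP := h2 _ vs'; rewrite !fun_applyE; lia.
  by split; apply/allP => v /hh[hP hQ]; rewrite ?hP ?hQ.
apply: pair_integral_ext (pair_integral_cos k (k - Q)) => t t'; congr cos.
rewrite -(pairing_sub _ us us' ss); last first.
  by move=> v vs; have := PQ v; have := out _ vs; rewrite !fun_applyE; lia.
rewrite /phase /pairing -!big_split; apply: eq_bigr => v _ /=.
rewrite fun_applyE rmorphB /=.
have -> : (P v)%:~R = 2 * (k v)%:~R - (Q v)%:~R :> R.
  have -> : P v = 2 * k v - Q v by have := PQ v; lia.
  by rewrite rmorphB rmorphM.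
rewrite /half_sum /half_diff; lra.
Qed.

Lemma cos_mul2cos (a b : R) : cos a * (2 * cos b) = cos (a + b) + cos (a - b).
Proof. by rewrite cosD cosB; lra. Qed.

(** Each factor [2 * cos] chooses a direction of its edge through the formula for a product of
    cosines. Reversing a direction changes the total charge by twice [bdry e], so a single parity
    condition on the multisets covers all choices. *)
Lemma pair_integral_multicos L L' P Q (k : V -> int) :
  edges_in s' L -> edges_in s' L' ->
  (forall v, P v + Q v + boundary L v + boundary L' v = 2 * k v) ->
  (forall v, v \notin s' -> P v = Q v) ->
  pair_integral (fun f f' => cos (phase P Q f f') *
      (multicos L (half_sum f f') * multicos L' (half_diff f f')))
    (orient_count R s L P * orient_count R s L' Q).
Proof.
elim: L P k => [|e L IH] P k /=; last first.
  move=> /andP[/andP[e1 e2] iL] iL' par out.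
  rewrite mulrDl.
  have outp v : v \notin s' -> (P + bdry e) v = Q v.
    by move=> vs; rewrite fun_applyE bdry_out// addr0; exact: out.
  have outm v : v \notin s' -> (P - bdry e) v = Q v.
    by move=> vs; rewrite !fun_applyE bdry_out// subr0; exact: out.
  have parp v : (P + bdry e) v + Q v + boundary L v + boundary L' v = 2 * k v.
    by rewrite -par boundary_cons fun_applyE; lia.
  have parm v : (P - bdry e) v + Q v + boundary L v + boundary L' v = 2 * (k - bdry e) v.
    by rewrite !fun_applyE mulrBr -par boundary_cons; lia.
  apply: pair_integral_ext (pair_integralD (IH _ _ iL iL' parp outp) (IH _ _ iL iL' parm outm)).
  move=> t t' /=; rewrite -mulrDl /phase (pairingD _ P (bdry e)) (pairingD _ P (- bdry e)) pairingN pairing_bdry ?ss//.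
  set b := half_sum _ _ _ - _; rewrite [_ + b + _]addrAC [_ - b + _]addrAC -cos_mul2cos.
  by rewrite /multicos big_cons -/b; lra.
move=> _ iL' par out.
have {}par v : P v + Q v + boundary L' v = 2 * k v.
  by rewrite -par /boundary big_nil addr0.
elim: L' Q k iL' par out => [|e L' IH] Q k /=.
  move=> _ par out.
  apply: (@pair_integral_ext (fun f f' => cos (phase P Q f f'))).
    by move=> t t'; rewrite /multicos !big_nil !mulr1.
  apply: (@pair_integral_phase _ _ k) => // v.
  by rewrite -par /boundary big_nil addr0.
move=> /andP[/andP[e1 e2] iL'] par out.
rewrite mulrDr.
have outp v : v \notin s' -> P v = (Q + bdry e) v.
  by move=> vs; rewrite fun_applyE bdry_out// addr0; exact: out.
have outm v : v \notin s' -> P v = (Q - bdry e) v.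
  by move=> vs; rewrite !fun_applyE bdry_out// subr0; exact: out.
have parp v : P v + (Q + bdry e) v + boundary L' v = 2 * k v.
  by rewrite -par boundary_cons fun_applyE; lia.
have parm v : P v + (Q - bdry e) v + boundary L' v = 2 * (k - bdry e) v.
  by rewrite !fun_applyE mulrBr -par boundary_cons; lia.
apply: pair_integral_ext (pair_integralD (IH _ _ iL' parp outp) (IH _ _ iL' parm outm)).
move=> t t' /=; rewrite -mulrDl /phase (pairingD _ Q (bdry e)) (pairingD _ Q (- bdry e)) pairingN pairing_bdry ?ss//.
set b := half_diff _ _ _ - _; rewrite (addrA _ _ b) (addrA _ _ (- b)) -cos_mul2cos.
by rewrite /multicos !big_nil big_cons -/b; lra.
Qed.

End TwoTori.
End PairIntegral.

(** * Expansion of polynomial weights into edge multisets *)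

Section Expansion.
Variables (R : realType) (V : choiceType).
Implicit Types (s : seq V) (f g : V -> R) (p P Q D : V -> int) (e : V * V) (L E C : seq (V * V)).
Implicit Types (r : {poly R}) (F : seq (R * seq (V * V))).

(** The charges are listed, not counted as in [orient_count]: each one enters both counts of a
    product. *)
Fixpoint shifts L : seq (V -> int) :=
  if L is e :: L' then [seq D + bdry e | D <- shifts L'] ++ [seq D - bdry e | D <- shifts L']
  else [:: 0].

Lemma pairing0 s f : pairing s 0 f = 0.
Proof. by rewrite /pairing big1// => v _; rewrite mul0r. Qed.

Lemma cos_multicos s L f (a : R) : uniq s -> edges_in s L ->
  cos a * multicos L f = \sum_(D <- shifts L) cos (a + pairing s D f).
Proof.
move=> us; elim: L a => [|e L IH] a /=.
  by rewrite /multicos big_nil big_seq1 pairing0 addr0 mulr1.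
move=> /andP[/andP[e1 e2] iL].
rewrite /multicos big_cons -/(multicos L f) mulrA cos_mul2cos mulrDl !IH//.
rewrite big_cat !big_map /=; congr (_ + _); apply: eq_bigr => D _; congr cos.
  by rewrite (pairingD _ D (bdry e)) pairing_bdry//; lra.
by rewrite (pairingD _ D (- bdry e)) pairingN pairing_bdry//; lra.
Qed.

Lemma shifts_out L v : all (fun e => (e.1 != v) && (e.2 != v)) L ->
  all (fun D => D v == 0) (shifts L : seq (V -> int)).
Proof.
elim: L => [|e L IH] //= /andP[/andP[e1 e2] /IH aL].
have be : bdry e v = 0.
  by rewrite /bdry !fun_applyE /dlt eq_sym (negPf e1) eq_sym (negPf e2).
by rewrite all_cat !all_map; apply/andP; split; apply: sub_all aL => D /= /eqP Dv;
  rewrite !fun_applyE Dv be.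
Qed.

Definition combination F f : R := \sum_(c <- F) c.1 * multicos c.2 f.

(** The exponent of a monomial becomes the multiplicity of the edge; [sel] restricts the exponents,
    by parity in [parity_families]. *)
Definition mul_edge r (sel : pred nat) e F :=
  [seq (r`_i * c.1, nseq i e ++ c.2) | i <- [seq i <- iota 0 (size r) | sel i], c <- F].

Definition part r (sel : pred nat) (x : R) := \sum_(i < size r | sel i) r`_i * x ^+ i.

Lemma multicos_cat L L' f : multicos (L ++ L') f = multicos L f * multicos L' f.
Proof. exact: big_cat. Qed.

Lemma multicos_nseq i e f : multicos (nseq i e) f = (2 * cos (f e.1 - f e.2)) ^+ i.
Proof. by rewrite /multicos big_nseq -Monoid.iteropE. Qed.

Lemma combination_mul_edge r sel e F f :
  combination (mul_edge r sel e F) f =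
  part r sel (2 * cos (f e.1 - f e.2)) * combination F f.
Proof.
rewrite /combination big_allpairs_dep /= big_filter /part mulr_suml.
have -> : iota 0 (size r) = index_iota 0 (size r) by rewrite /index_iota subn0.
rewrite big_mkord.
apply: eq_bigr => i _; rewrite mulr_sumr; apply: eq_bigr => c _.
by rewrite multicos_cat multicos_nseq; lra.
Qed.

Lemma part_predT r x : part r predT x = r.[x].
Proof. by rewrite horner_coef. Qed.

Definition expand r C := foldr (mul_edge r predT) [:: (1, [::])] C.

Lemma combination_unit f : combination [:: (1, [::])] f = 1.
Proof. by rewrite /combination big_seq1 /multicos big_nil mulr1. Qed.

Lemma combination_expand r C f :
  combination (expand r C) f = \prod_(e <- C) r.[2 * cos (f e.1 - f e.2)].
Proof.
elim: C => [|e C IH] /=; first by rewrite big_nil combination_unit.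
by rewrite big_cons combination_mul_edge part_predT IH.
Qed.

Definition even := fun i : nat => ~~ odd i.

Fixpoint parity_families r E : seq (seq (R * seq (V * V))) :=
  if E is e :: E' then
    [seq mul_edge r even e F | F <- parity_families r E'] ++
    [seq mul_edge r odd e F | F <- parity_families r E']
  else [:: [:: (1, [::])]].

Definition parity_kernel r (x y : R) := part r even x * part r even y + part r odd x * part r odd y.

Lemma sum_parity_families r E f g :
  \sum_(F <- parity_families r E) combination F f * combination F g =
  \prod_(e <- E) parity_kernel r (2 * cos (f e.1 - f e.2)) (2 * cos (g e.1 - g e.2)).
Proof.
elim: E => [|e E IH] /=; first by rewrite big_seq1 big_nil !combination_unit mulr1.
rewrite big_cat !big_map /= big_cons -IH /parity_kernel mulrDl; congr (_ + _).
  by rewrite mulr_sumr; apply: eq_bigr => F _; rewrite !combination_mul_edge; lra.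
by rewrite mulr_sumr; apply: eq_bigr => F _; rewrite !combination_mul_edge; lra.
Qed.

(** The mixed products of an even and an odd part cancel between (x, y) and (-x, -y). For x and y
    twice a cosine, this sign change is the shift of both angles by pi in the product formula for
    the weights. *)
Lemma parity_kernelE r x y :
  parity_kernel r x y = (r.[x] * r.[y] + r.[- x] * r.[- y]) / 2.
Proof.
have pe z : r.[z] = part r even z + part r odd z.
  by rewrite horner_coef (bigID (fun i : 'I__ => odd i)) /= addrC.
have po z : r.[- z] = part r even z - part r odd z.
  rewrite horner_coef (bigID (fun i : 'I__ => odd i)) /= addrC -sumrN; congr (_ + _).
    by apply: eq_bigr => i /negPf oi; rewrite exprNn -signr_odd oi mul1r.
  by apply: eq_bigr => i oi; rewrite exprNn -signr_odd oi mulN1r mulrN.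
by rewrite !po !pe /parity_kernel; lra.
Qed.

Lemma boundary_cat L L' v : boundary (L ++ L') v = boundary L v + boundary L' v.
Proof. by rewrite /boundary big_cat. Qed.

Lemma boundary_nseq i e v : boundary (nseq i e) v = i%:Z * bdry e v.
Proof.
elim: i => [|i IH]; first by rewrite /boundary big_nil mul0r.
by rewrite /= boundary_cons IH -addn1 PoszD; lia.
Qed.

Lemma mem_mul_edge r sel e F c : c \in mul_edge r sel e F ->
  exists i c', [/\ sel i, c' \in F & c = (r`_i * c'.1, nseq i e ++ c'.2)].
Proof.
by case/allpairsPdep => i [c' [+ c'F ->]]; rewrite mem_filter => /andP[si _]; exists i, c'.
Qed.

Lemma expand_subset r C c : c \in expand r C -> {subset c.2 <= C}.
Proof.
elim: C c => [|e C IH] c /=; first by rewrite inE => /eqP ->.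
move=> /mem_mul_edge[i [c' [_ /IH sub ->]]] x /=.
rewrite mem_cat mem_nseq inE => /orP[/andP[_ ->]//|/sub ->]; exact: orbT.
Qed.

Lemma parity_families_subset r E F c : F \in parity_families r E -> c \in F ->
  {subset c.2 <= E}.
Proof.
elim: E F c => [|e E IH] F c /=; first by rewrite inE => /eqP ->; rewrite inE => /eqP ->.
have step sel F' : F' \in parity_families r E -> c \in mul_edge r sel e F' -> {subset c.2 <= e :: E}.
  move=> F'E /mem_mul_edge[i [c' [_ c'F ->]]] x /=.
  rewrite mem_cat mem_nseq inE => /orP[/andP[_ ->]//|/(IH _ _ F'E c'F) ->]; exact: orbT.
by rewrite mem_cat => /orP[] /mapP[F' F'E ->]; exact: step.
Qed.

(** In two members of one family an edge has multiplicities of the same parity, so their sum is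
    even. This is the integrality needed to integrate in half-angles. *)
Lemma parity_families_even r E F c c' : F \in parity_families r E -> c \in F -> c' \in F ->
  exists k : V -> int, forall v, boundary c.2 v + boundary c'.2 v = 2 * k v.
Proof.
elim: E F c c' => [|e E IH] F c c' /=.
  rewrite inE => /eqP ->; rewrite !inE => /eqP -> /eqP ->.
  by exists 0 => v; rewrite /boundary big_nil.
have step (sel : pred nat) F' : (forall i j, sel i -> sel j -> odd i = odd j) ->
    F' \in parity_families r E -> c \in mul_edge r sel e F' -> c' \in mul_edge r sel e F' ->
    exists k : V -> int, forall v, boundary c.2 v + boundary c'.2 v = 2 * k v.
  move=> selP F'E /mem_mul_edge[i [d [si dF ->]]] /mem_mul_edge[j [d' [sj d'F ->]]].
  have [k kE] := IH _ _ _ F'E dF d'F; have ij := selP _ _ si sj.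
  exists (fun v => k v + ((i + j)./2)%:Z * bdry e v) => v /=.
  rewrite !boundary_cat !boundary_nseq.
  have -> : (i%:Z * bdry e v + boundary d.2 v + (j%:Z * bdry e v + boundary d'.2 v) =
    (boundary d.2 v + boundary d'.2 v) + (i + j)%:Z * bdry e v) by rewrite PoszD mulrDl; lia.
  have -> : (i + j)%:Z = 2 * ((i + j)./2)%:Z.
    rewrite -[in LHS](odd_double_half (i + j)) oddD ij addbb add0n -mul2n PoszM; lia.
  by rewrite kE; lia.
rewrite mem_cat => /orP[] /mapP[F' F'E ->]; apply: step => //.
  by move=> i j /negPf -> /negPf ->.
by move=> i j -> ->.
Qed.

Lemma expand_ge0 r C c : r \is a polyOver Num.nneg -> c \in expand r C -> 0 <= c.1.
Proof.
move=> /polyOverP r0; elim: C c => [|e C IH] c /=; first by rewrite inE => /eqP ->.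
by move=> /mem_mul_edge[i [c' [_ /IH c0 ->]]] /=; rewrite mulr_ge0// -nnegrE.
Qed.

Lemma parity_families_ge0 r E F c : r \is a polyOver Num.nneg ->
  F \in parity_families r E -> c \in F -> 0 <= c.1.
Proof.
move=> /polyOverP r0; elim: E F c => [|e E IH] F c /=.
  by rewrite inE => /eqP ->; rewrite inE => /eqP ->.
have step sel F' : F' \in parity_families r E -> c \in mul_edge r sel e F' -> 0 <= c.1.
  move=> F'E /mem_mul_edge[i [c' [_ /(IH _ _ F'E) c0 ->]]] /=.
  by rewrite mulr_ge0// -nnegrE.
by rewrite mem_cat => /orP[] /mapP[F' F'E ->]; exact: step.
Qed.

(** In the value defined next, [c] and [D] run over the monomials and directions of the unrotated
    edges [C], and [F] over the parity assignments on the rotated edges [E]. *)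
Definition weighted_count s F P : R := \sum_(c <- F) c.1 * orient_count R s c.2 P.

Definition pair_value s r0 r1 C E P Q : R :=
  \sum_(c <- expand r0 C) c.1 *
    \sum_(D <- shifts c.2)
      \sum_(F <- parity_families r1 E) weighted_count s F (P + D) * weighted_count s F (Q + D).

Lemma pair_integral_sumT s s' (I : Type) (l : seq I) (h : I -> (V -> R) -> (V -> R) -> R) (c : I -> R) :
  (forall i, pair_integral s s' (h i) (c i)) ->
  pair_integral s s' (fun f f' => \sum_(i <- l) h i f f') (\sum_(i <- l) c i).
Proof.
move=> hl; elim: l => [|i l IH].
  rewrite big_nil; apply: pair_integral_ext (pair_integral0 _ s s') => t t'.
  by rewrite big_nil.
rewrite big_cons; apply: (@pair_integral_ext _ _ _ _ (fun f f' => h i f f' + \sum_(j <- l) h j f f')).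
  by move=> t t'; rewrite big_cons.
exact: pair_integralD.
Qed.

Lemma edges_in_sub s L E : {subset L <= E} -> edges_in s E -> edges_in s L.
Proof. by move=> LE /allP EE; apply/allP => e /LE/EE. Qed.

Lemma pair_integral_families s s' r E P Q (k : V -> int) :
  uniq s -> uniq s' -> {subset s' <= s} -> edges_in s' E ->
  (forall v, P v + Q v = 2 * k v) -> (forall v, v \notin s' -> P v = Q v) ->
  pair_integral s s' (fun f f' => cos (phase s P Q f f') *
      \prod_(e <- E) parity_kernel r (2 * cos (half_sum f f' e.1 - half_sum f f' e.2))
                                     (2 * cos (half_diff f f' e.1 - half_diff f f' e.2)))
    (\sum_(F <- parity_families r E) weighted_count s F P * weighted_count s F Q).
Proof.
move=> us us' ss iE PQ out.
apply: (@pair_integral_ext _ _ _ _ (fun f f' => \sum_(F <- parity_families r E)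
   \sum_(c <- F) \sum_(c' <- F) (c.1 * c'.1) * (cos (phase s P Q f f') *
      (multicos c.2 (half_sum f f') * multicos c'.2 (half_diff f f'))))).
  move=> t t'; rewrite -sum_parity_families mulr_sumr; apply: eq_bigr => F _.
  rewrite /combination mulr_suml mulr_sumr; apply: eq_bigr => c _.
  by rewrite !mulr_sumr; apply: eq_bigr => c' _; lra.
apply: pair_integral_sum => F FE.
have -> : weighted_count s F P * weighted_count s F Q =
   \sum_(c <- F) \sum_(c' <- F) (c.1 * c'.1) * (orient_count R s c.2 P * orient_count R s c'.2 Q).
  rewrite /weighted_count mulr_suml; apply: eq_bigr => c _.
  by rewrite mulr_sumr; apply: eq_bigr => c' _; lra.
apply: pair_integral_sum => c cF; apply: pair_integral_sum => c' c'F.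
apply: pair_integralZ.
have [k' k'E] := parity_families_even FE cF c'F.
apply: (@pair_integral_multicos _ _ _ _ us us' ss _ _ _ _ (fun v => k v + k' v)) => //.
- by apply: edges_in_sub iE; exact: parity_families_subset FE cF.
- by apply: edges_in_sub iE; exact: parity_families_subset FE c'F.
- by move=> v; rewrite mulrDr -PQ -k'E addrA.
Qed.

(** The first angle is the sum of the half sum and the half difference, so a charge on it alone is
    added to both [P] and [Q]. *)
Lemma phase_shift s P Q D f f' :
  phase s (P + D) (Q + D) f f' = phase s P Q f f' + pairing s D f.
Proof.
rewrite /phase !pairingD -!addrA; congr (_ + _); rewrite addrCA; congr (_ + _).
rewrite /pairing -big_split; apply: eq_bigr => v _ /=.
by rewrite /half_sum /half_diff; lra.
Qed.

Lemma pair_integral_value s s' r0 r1 C E P Q (k : V -> int) :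
  uniq s -> uniq s' -> {subset s' <= s} -> edges_in s' E -> edges_in s C ->
  (forall v, P v + Q v = 2 * k v) -> (forall v, v \notin s' -> P v = Q v) ->
  pair_integral s s' (fun f f' => cos (phase s P Q f f') *
      (\prod_(e <- C) r0.[2 * cos (f e.1 - f e.2)] *
       \prod_(e <- E) parity_kernel r1 (2 * cos (half_sum f f' e.1 - half_sum f f' e.2))
                                     (2 * cos (half_diff f f' e.1 - half_diff f f' e.2))))
    (pair_value s r0 r1 C E P Q).
Proof.
move=> us us' ss iE iC PQ out.
pose K f f' := \prod_(e <- E) parity_kernel r1 (2 * cos (half_sum f f' e.1 - half_sum f f' e.2))
                                     (2 * cos (half_diff f f' e.1 - half_diff f f' e.2)).
apply: (@pair_integral_ext _ _ _ _ (fun f f' => \sum_(c <- expand r0 C) c.1 *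
   \sum_(D <- shifts c.2 : seq (V -> int)) cos (phase s (P + D) (Q + D) f f') * K f f')).
  move=> t t'; rewrite -combination_expand /combination mulrA mulr_sumr mulr_suml.
  rewrite big_seq [RHS]big_seq; apply: eq_bigr => c cC.
  rewrite mulrCA -mulrA; congr (_ * _); rewrite -mulr_suml -/(K _ _); congr (_ * _).
  rewrite (cos_multicos _ _ us); last by apply: edges_in_sub iC; exact: expand_subset cC.
  by apply: eq_bigr => D _; rewrite phase_shift.
apply: pair_integral_sum => c cC; apply: pair_integralZ; apply: pair_integral_sumT => D.
apply: (@pair_integral_families _ _ _ _ _ _ (fun v => k v + D v)) => // v.
  by have := PQ v; rewrite !fun_applyE; lia.
by move=> /out; rewrite !fun_applyE => ->.
Qed.
End Expansion.

(** * Passage from polynomial weights to Villain weights *)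

Section Limits.
Variables (R : realType) (V : choiceType).
Implicit Types (s : seq V) (f g : V -> R) (p P Q D : V -> int) (e : V * V) (L E C : seq (V * V)).

Lemma normr_horner_le (q : {poly R}) (x : R) : q \is a polyOver Num.nneg -> `|x| <= 1 ->
  `|q.[x]| <= q.[1].
Proof.
move=> /polyOverP q0 x1; rewrite !horner_coef; apply: le_trans (ler_norm_sum _ _ _) _.
apply: ler_sum => i _; have qi : 0 <= q`_i by rewrite -nnegrE.
by rewrite expr1n mulr1 normrM (ger0_norm qi) ler_piMr// normrX exprn_ile1.
Qed.

(** [r0] serves the unrotated edges at [b], and [r1] the rotated ones at [2 * b]. Arguments are
    twice a cosine, hence the rescaling by 1/2; the factor [Num.sqrt 2] cancels the 1/2 in
    [parity_kernelE]. Nonnegative coefficients make the value at 1 = cos 0 bound a polynomial on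
    [-1, 1], and these values converge. *)
Lemma weight_approximants (b : R) : 0 < b -> exists (r0 r1 : nat -> {poly R}) (B : R),
  [/\ forall a, r0 a \is a polyOver Num.nneg /\ r1 a \is a polyOver Num.nneg,
      forall a t, `|(r0 a).[2 * cos t]| <= B,
      forall a x y, `|parity_kernel (r1 a) (2 * cos x) (2 * cos y)| <= B,
      forall t, (r0 a).[2 * cos t] @[a --> \oo] --> villain_weight b t &
      forall x y, parity_kernel (r1 a) (2 * cos x) (2 * cos y) @[a --> \oo] -->
        villain_weight b (x + y) * villain_weight b (x - y)].
Proof.
move=> b0; have b20 : 0 < 2 * b by rewrite mulr_gt0.
have bnd (q : nat -> {poly R}) (c : R) : (forall a, q a \is a polyOver Num.nneg) ->
    (q a).[cos 0] @[a --> \oo] --> c -> exists B : R, forall a (x : R), `|x| <= 1 -> `|(q a).[x]| <= B.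
  move=> q0 qc; have [B Bq] : has_ubound (range (fun a => (q a).[1])).
    apply/bounded_fun_has_ubound/cvg_seq_bounded/cvg_ex; exists c.
    by move: qc; rewrite cos0.
  exists B => a x x1; apply: le_trans (normr_horner_le (q0 a) x1) _.
  by apply: Bq; exists a.
have [q0 [q0n q0c]] := villain_weight_cos_poly b0.
have [q1 [q1n q1c]] := villain_weight_cos_poly b20.
have [B0 q0B] := bnd _ _ q0n (q0c 0); have [B1 q1B] := bnd _ _ q1n (q1c 0).
have B10 : 0 <= B1 by apply: le_trans (q1B 0%N 0 _); rewrite ?normr0.
have lin (q : {poly R}) (x : R) : (q \Po (2^-1 *: 'X)).[2 * x] = q.[x].
  by rewrite horner_comp hornerZ hornerX mulKf.
have linN (q : {poly R}) (x : R) : (q \Po (2^-1 *: 'X)).[- (2 * x)] = q.[- x].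
  by rewrite -mulrN lin.
have nn (q : {poly R}) : q \is a polyOver Num.nneg -> q \Po (2^-1 *: 'X) \is a polyOver Num.nneg.
  by move=> qn; apply: polyOver_comp => //; rewrite polyOverZ ?nnegrE// polyOverX.
have ker a x y : parity_kernel (Num.sqrt 2 *: (q1 a \Po (2^-1 *: 'X))) (2 * cos x) (2 * cos y) =
    (q1 a).[cos x] * (q1 a).[cos y] + (q1 a).[- cos x] * (q1 a).[- cos y].
  rewrite parity_kernelE !hornerZ !linN !lin.
  have s2 (u v : R) : Num.sqrt 2 * u * (Num.sqrt 2 * v) = 2 * (u * v).
    by rewrite mulrACA -expr2 sqr_sqrtr.
  by rewrite !s2; lra.
exists (fun a => q0 a \Po (2^-1 *: 'X)), (fun a => Num.sqrt 2 *: (q1 a \Po (2^-1 *: 'X))), (B0 + 2 * B1 ^+ 2).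
have b1 x : `|cos x| <= 1 :> R := cos_max x.
have b2 x : `|- cos x| <= 1 :> R by rewrite normrN.
have B00 : 0 <= B0 by apply: le_trans (q0B 0%N 0 _); rewrite ?normr0.
have B11 : 0 <= B1 ^+ 2 by rewrite exprn_ge0.
split.
- by move=> a; split; [exact: nn | rewrite polyOverZ ?nnegrE ?sqrtr_ge0// nn].
- by move=> a t; rewrite lin (le_trans (q0B _ _ _))//; lra.
- move=> a x y; rewrite ker (le_trans (ler_normD _ _))// !normrM.
  have h1 : `|(q1 a).[cos x]| * `|(q1 a).[cos y]| <= B1 ^+ 2 by rewrite expr2 ler_pM ?q1B.
  have h2 : `|(q1 a).[- cos x]| * `|(q1 a).[- cos y]| <= B1 ^+ 2 by rewrite expr2 ler_pM ?q1B.
  by lra.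
- by move=> t; under eq_fun do rewrite lin; exact: q0c.
- move=> x y; under eq_fun do rewrite ker -!cosDpi.
  rewrite villain_weight_mul//.
  have -> : (x + y + (x - y)) / 2 = x by lra.
  have -> : (x + y - (x - y)) / 2 = y by lra.
  by apply: cvgD; apply: cvgM; exact: q1c.
Qed.

Definition edge_product b E f : R := \prod_(e <- E) villain_weight b (f e.1 - f e.2).

Definition cos_integral b s E p : R :=
  torus_int (fun t : (size s).-tuple R =>
    cos (pairing s p (angle_of t)) * edge_product b E (angle_of t)).

Lemma measurable_villain_weight b : 0 < b -> measurable_fun setT (@villain_weight R b).
Proof.
move=> /weight_approximants [r0 [_ [B [_ _ _ r0c _]]]].
apply: (@measurable_fun_cvg _ _ _ _ (fun a t => (r0 a).[2 * cos t])) => [a|t _]; last exact: r0c.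
apply: (measurableT_comp (f := fun x => (r0 a).[x])).
  by apply: continuous_measurable_fun; exact: continuous_horner.
apply: measurable_funM; first exact: measurable_cst.
by apply: continuous_measurable_fun; exact: continuous_cos.
Qed.

Lemma cvgn_ler (u : nat -> R) (l M : R) :
  u a @[a --> \oo] --> l -> (forall a, u a <= M) -> l <= M.
Proof.
move=> ul uM; have /cvg_lim <- // := ul; apply: limr_le; last exact: nearW.
by apply/cvg_ex; exists l.
Qed.

Lemma villain_weight_bounded b : 0 < b -> exists B, forall t : R, `|villain_weight b t| <= B.
Proof.
move=> b0; have [r0 [_ [B [_ r0B _ r0c _]]]] := weight_approximants b0.
exists B => t; rewrite ger0_norm; last by rewrite ltW// villain_weight_gt0.
apply: (cvgn_ler (r0c t)) => a; exact: le_trans (ler_norm _) (r0B _ _).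
Qed.

Lemma bounded_measurable_edge_product b s E : 0 < b ->
  bounded_measurable (fun t : (size s).-tuple R => edge_product b E (angle_of t)).
Proof.
move=> b0; apply: bounded_measurable_prod => e; split.
  apply: measurableT_comp; first exact: measurable_villain_weight.
  by apply: measurable_funB; exact: measurable_angle_of.
by have [B wB] := villain_weight_bounded b0; exists B => t.
Qed.

Lemma bounded_measurable_cos_pairing s p :
  bounded_measurable (fun t : (size s).-tuple R => cos (pairing s p (angle_of t))).
Proof.
apply: bounded_measurable_cos; have := @measurable_pairing R V s s p 0.
by under eq_fun do rewrite addr0.
Qed.

Lemma bounded_measurable_integrand b s E p : 0 < b ->
  bounded_measurable (fun t : (size s).-tuple R =>
    cos (pairing s p (angle_of t)) * edge_product b E (angle_of t)).
Proof.
move=> b0; apply: bounded_measurableM; first exact: bounded_measurable_cos_pairing.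
exact: bounded_measurable_edge_product.
Qed.

Lemma normr_torus_int n (f : n.-tuple R -> R) (C : R) :
  measurable_fun setT f -> (forall t, `|f t| <= C) -> `|torus_int f| <= (2 * pi) ^+ n * C.
Proof.
move=> mf fC.
have bf : bounded_measurable f by split => //; exists C.
rewrite ler_norml -mulrN -!torus_int_cst; apply/andP; split; apply: le_torus_int => //;
  try exact: bounded_measurable_cst; by move=> t _; have := fC t; rewrite ler_norml => /andP[].
Qed.

(** Dominated convergence for the inner and then the outer integral; the measurability of both
    limits is inherited from the approximants. *)
Lemma cvg_pair_integral s s' (h_ : nat -> (V -> R) -> (V -> R) -> R) (c_ : nat -> R)
    (h : (V -> R) -> (V -> R) -> R) (C : R) :
  (forall a, pair_integral s s' (h_ a) (c_ a)) ->
  (forall a f f', `|h_ a f f'| <= C) ->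
  (forall f f', h_ a f f' @[a --> \oo] --> h f f') ->
  c_ a * (2 * pi) ^+ (size s + size s') @[a --> \oo] -->
    torus_int (fun t : (size s).-tuple R =>
      torus_int (fun t' : (size s').-tuple R => h (angle_of t) (angle_of t'))).
Proof.
move=> hc hC hh.
have inner (t : (size s).-tuple R) :
    torus_int (fun t' : (size s').-tuple R => h_ a (angle_of t) (angle_of t')) @[a --> \oo] -->
    torus_int (fun t' : (size s').-tuple R => h (angle_of t) (angle_of t')).
  apply: (@cvg_torus_int _ _ _ _ C) => //.
  - by move=> a; have [/(_ t)[]] := hc a.
  - apply: (@measurable_fun_cvg _ _ _ _ (fun a (t' : (size s').-tuple R) => h_ a (angle_of t) (angle_of t'))) => //.
    by move=> a; have [/(_ t)[]] := hc a.
have -> : (fun a => c_ a * (2 * pi) ^+ (size s + size s')) = (fun a => torus_int (fun t : (size s).-tuple R =>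
      torus_int (fun t' : (size s').-tuple R => h_ a (angle_of t) (angle_of t')))).
  by apply/funext => a; have [_ _ ->] := hc a.
apply: (@cvg_torus_int _ _ _ _ ((2 * pi) ^+ size s' * C)) => //.
- by move=> a; have [_ []] := hc a.
- apply: (@measurable_fun_cvg _ _ _ _ (fun a (t : (size s).-tuple R) =>
    torus_int (fun t' : (size s').-tuple R => h_ a (angle_of t) (angle_of t')))) => [a|t _].
    by have [_ []] := hc a.
  exact: inner.
- move=> a t; apply: normr_torus_int => // .
  by have [/(_ t)[]] := hc a.
Qed.

Lemma pair_valueC s r0 r1 C E P Q :
  pair_value s r0 r1 C E P Q = pair_value s r0 r1 C E Q P :> R.
Proof.
apply: eq_bigr => c _; congr (_ * _); apply: eq_bigr => D _; apply: eq_bigr => F _.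
exact: mulrC.
Qed.

Lemma phase_add s p P f f' :
  phase s (p + P) (p - P) f f' = pairing s p f + pairing s P f'.
Proof.
rewrite /phase /pairing -!big_split; apply: eq_bigr => v _ /=.
by rewrite !fun_applyE rmorphB rmorphD /= /half_sum /half_diff; lra.
Qed.

Lemma phase_sub s p P f f' :
  phase s (p - P) (p + P) f f' = pairing s p f - pairing s P f'.
Proof. by have := phase_add s p (- P) f f'; rewrite opprK pairingN. Qed.

Lemma normr_prod_le (I : Type) (l : seq I) (F : I -> R) (B : R) :
  (forall i, `|F i| <= B) -> `|\prod_(i <- l) F i| <= B ^+ size l.
Proof.
move=> FB; elim: l => [|i l IH]; first by rewrite big_nil normr1 expr0.
by rewrite big_cons normrM exprS ler_pM.
Qed.

(** The approximants are fixed before the graphs and charges, so that limits for different charges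
    can be compared at each [a]. *)
Lemma cvg_pair_value b : 0 < b -> exists r0 r1 : nat -> {poly R},
  (forall a, r0 a \is a polyOver Num.nneg /\ r1 a \is a polyOver Num.nneg) /\
  forall s s' C E p p', uniq s -> uniq s' -> {subset s' <= s} ->
    edges_in s' E -> edges_in s C -> (forall v, v \notin s' -> p' v = 0) ->
    pair_value s (r0 a) (r1 a) C E (p + p') (p - p') * (2 * pi) ^+ (size s + size s')
      @[a --> \oo] --> cos_integral b s (C ++ E) p * cos_integral b s' E p'.
Proof.
move=> b0; have [r0 [r1 [B [rn r0B r1B r0c r1c]]]] := weight_approximants b0.
exists r0, r1; split=> // s s' C E p p' us us' ss iE iC out.
have B0 : 0 <= B := le_trans (normr_ge0 _) (r0B 0%N 0).
pose W a f f' := \prod_(e <- C) (r0 a).[2 * cos (f e.1 - f e.2)] *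
       \prod_(e <- E) parity_kernel (r1 a) (2 * cos (half_sum f f' e.1 - half_sum f f' e.2))
                                     (2 * cos (half_diff f f' e.1 - half_diff f f' e.2)) : R.
have WB a f f' : `|W a f f'| <= B ^+ size C * B ^+ size E.
  by rewrite normrM ler_pM//; apply: normr_prod_le => e; [exact: r0B | exact: r1B].
have Wc f f' : W a f f' @[a --> \oo] --> edge_product b (C ++ E) f * edge_product b E f'.
  rewrite /edge_product big_cat /= -mulrA -big_split /=; apply: cvgM.
    by apply: cvg_big => [|e _]; [exact: mul_continuous | exact: r0c].
  apply: cvg_big => [|e _]; first exact: mul_continuous.
  set x := half_sum f f' e.1 - half_sum f f' e.2.
  set y := half_diff f f' e.1 - half_diff f f' e.2.
  have -> : f e.1 - f e.2 = x + y by rewrite /x /y /half_sum /half_diff; lra.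
  have -> : f' e.1 - f' e.2 = x - y by rewrite /x /y /half_sum /half_diff; lra.
  exact: r1c.
have PQ v : (p + p') v + (p - p') v = 2 * p v by rewrite !fun_applyE; lia.
have PQ' v : (p - p') v + (p + p') v = 2 * p v by rewrite addrC.
have outPQ v : v \notin s' -> (p + p') v = (p - p') v.
  by move=> vs; rewrite !fun_applyE (out v vs).
have outQP v : v \notin s' -> (p - p') v = (p + p') v by move=> /outPQ.
have value a : pair_integral s s'
    (fun f f' => cos (pairing s p f) * cos (pairing s' p' f') * W a f f')
    (pair_value s (r0 a) (r1 a) C E (p + p') (p - p')).
  have V1 := pair_integral_value (r0 a) (r1 a) us us' ss iE iC PQ outPQ.
  have V2 := pair_integral_value (r0 a) (r1 a) us us' ss iE iC PQ' outQP.
  (* A product of cosines is half of cos(x + y) + cos(x - y): two phases with [P] and [Q] exchanged,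
     which have the same value. *)
  have -> : pair_value s (r0 a) (r1 a) C E (p + p') (p - p') = 2^-1 *
      (pair_value s (r0 a) (r1 a) C E (p + p') (p - p') +
       pair_value s (r0 a) (r1 a) C E (p - p') (p + p')).
    by rewrite (pair_valueC _ _ _ _ _ (p - p')); lra.
  apply: pair_integral_ext (pair_integralZ 2^-1 (pair_integralD V1 V2)) => t t' /=.
  rewrite -mulrDl -/(W a _ _) phase_add phase_sub.
  rewrite (pairing_sub _ us us' ss out).
  set x := pairing s p _; set y := pairing s' p' _; rewrite cosD cosB; lra.
have H1 a f f' : `|cos (pairing s p f) * cos (pairing s' p' f') * W a f f'| <= B ^+ size C * B ^+ size E.
  rewrite normrM -[leRHS]mul1r ler_pM// normrM -[leRHS]mul1r.
  by apply: ler_pM; rewrite ?cos_max.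
have H2 f f' : cos (pairing s p f) * cos (pairing s' p' f') * W a f f' @[a --> \oo] -->
    cos (pairing s p f) * cos (pairing s' p' f') * (edge_product b (C ++ E) f * edge_product b E f').
  by apply: cvgM; [exact: cvg_cst | exact: Wc].
have := cvg_pair_integral value H1 H2.
have BP := bounded_measurable_integrand.
rewrite (_ : (fun t : (size s).-tuple R => _) = (fun t : (size s).-tuple R =>
    cos_integral b s' E p' * (cos (pairing s p (angle_of t)) * edge_product b (C ++ E) (angle_of t)))).
  by rewrite torus_intZ; [rewrite [cos_integral b s' E p' * _]mulrC | exact: BP].
apply/funext => t; rewrite mulrC -torus_intZ; last exact: BP.
by congr torus_int; apply/funext => t'; lra.
Qed.
End Limits.

(** * Ginibre and Lieb inequalities for the unnormalized integrals *)

Section CorrelationInequalities.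
Variables (R : realType) (V : choiceType).
Implicit Types (s : seq V) (f g : V -> R) (p P Q D A : V -> int) (e : V * V) (L E C : seq (V * V)).

Lemma cvgn_ler2 (u v : nat -> R) (l m : R) :
  u a @[a --> \oo] --> l -> v a @[a --> \oo] --> m -> (forall a, u a <= v a) -> l <= m.
Proof.
move=> ul vm uv; rewrite -subr_le0.
by apply: (cvgn_ler (cvgB ul vm)) => a; rewrite subr_le0.
Qed.

Lemma weighted_count_ge0 s (F : seq (R * seq (V * V))) P :
  (forall c, c \in F -> 0 <= c.1) -> 0 <= weighted_count s F P.
Proof.
move=> F0; rewrite /weighted_count big_seq sumr_ge0// => c /F0 c0.
by rewrite mulr_ge0// orient_count_ge0.
Qed.

Lemma cos_integralN b s E p : cos_integral b s E (- p) = cos_integral b s E p :> R.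
Proof. by apply: torus_int_ext => t _; rewrite pairingN cosN. Qed.

Lemma ginibre_cos_integral b s s' C E A : 0 < b -> uniq s -> uniq s' -> {subset s' <= s} ->
  edges_in s' E -> edges_in s C -> (forall v, v \notin s' -> A v = 0) ->
  cos_integral b s (C ++ E) 0 * cos_integral b s' E A <=
  cos_integral b s (C ++ E) A * cos_integral b s' E 0 :> R.
Proof.
move=> b0 us us' ss iE iC out.
have [r0 [r1 [rn lim]]] := @cvg_pair_value R V b b0.
have out0 v : v \notin s' -> (0 : V -> int) v = 0 by [].
have l1 := lim _ _ _ _ 0 A us us' ss iE iC out.
have l2 := lim _ _ _ _ A 0 us us' ss iE iC out0.
have l3 := lim _ _ _ _ (- A) 0 us us' ss iE iC out0.
rewrite cos_integralN in l3.
(* The square of a difference needs both squares, at charges [A] and [-A], and the shifts [D] make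
   these different counts. The inequality is therefore doubled, with one copy of the right side
   computed at [-A]. *)
suff : cos_integral b s (C ++ E) 0 * cos_integral b s' E A +
       cos_integral b s (C ++ E) 0 * cos_integral b s' E A <=
       cos_integral b s (C ++ E) A * cos_integral b s' E 0 +
       cos_integral b s (C ++ E) A * cos_integral b s' E 0 :> R by lra.
apply: (cvgn_ler2 (cvgD l1 l1) (cvgD l2 l3)) => a /=.
rewrite -!mulrDl ler_pM2r ?exprn_gt0 ?mulr_gt0 ?pi_gt0//.
rewrite /pair_value -!big_split /= big_seq [leRHS]big_seq; apply: ler_sum => c cC.
rewrite -!mulrDr ler_wpM2l ?(expand_ge0 (rn a).1 cC)//.
rewrite -!big_split /=; apply: ler_sum => D _; rewrite -!big_split /=; apply: ler_sum => F _.
rewrite !(addr0, subr0, add0r, sub0r); set y1 := weighted_count _ _ _; set y2 := weighted_count _ _ _.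
have : 0 <= (y1 - y2) ^+ 2 by rewrite sqr_ge0.
rewrite expr2; lra.
Qed.

Lemma cos_integral_nil b : cos_integral b [::] [::] (0 : V -> int) = 1 :> R.
Proof.
rewrite /cos_integral -[RHS]mul1r -[in RHS](expr0 (2 * pi)) -torus_int_cst.
by apply: torus_int_ext => t _; rewrite /pairing /edge_product !big_nil cos0 mulr1.
Qed.

(** All edges are left unrotated against an empty second system whose integral is 1. Then [P] and
    [Q] both equal [p], and the value is a nonnegative combination of squares. *)
Lemma cos_integral_ge0 b s E p : 0 < b -> uniq s -> edges_in s E ->
  0 <= cos_integral b s E p :> R.
Proof.
move=> b0 us iE; have [r0 [r1 [rn lim]]] := @cvg_pair_value R V b b0.
have sn : {subset ([::] : seq V) <= s} by [].
have := lim s [::] E [::] p 0 us isT sn isT iE (fun _ _ => erefl).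
rewrite cats0 cos_integral_nil mulr1 => l.
apply: (cvgn_ler2 (cvg_cst 0) l) => a.
rewrite mulr_ge0 ?exprn_ge0 ?mulr_ge0 ?pi_ge0//.
rewrite /pair_value big_seq; apply: sumr_ge0 => c cE.
rewrite mulr_ge0 ?(expand_ge0 (rn a).1 cE)//; apply: sumr_ge0 => D _; apply: sumr_ge0 => F _.
by rewrite !(addr0, subr0) -expr2 sqr_ge0.
Qed.

Lemma cos_integral_gt0 b s E : 0 < b -> 0 < cos_integral b s E (0 : V -> int) :> R.
Proof.
(* Angles are at most pi in absolute value, so differences are at most 2 pi and [d] bounds every
   weight from below. *)
move=> b0; pose d := expR (- (b / 2) * (2 * pi) ^+ 2) : R.
have d0 : 0 < d := expR_gt0 _.
apply: (@lt_le_trans _ _ ((2 * pi) ^+ size s * d ^+ size E)).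
  by rewrite mulr_gt0 ?exprn_gt0 ?mulr_gt0 ?pi_gt0.
rewrite -torus_int_cst; apply: le_torus_int.
- exact: bounded_measurable_cst.
- exact: bounded_measurable_integrand.
move=> t tT; rewrite pairing0 cos0 mul1r /edge_product.
have ang v : `|angle_of t v| <= pi.
  rewrite /angle_of; have [vs|vs] := ltnP (index v s) (size s); last first.
    by rewrite nth_default ?size_tuple// normr0 pi_ge0.
  have := tT (Ordinal vs); rewrite (tnth_nth 0) /= => /andP[h1 h2].
  by rewrite ler_norml h1 ltW.
elim: E => [|e E IH]; first by rewrite big_nil expr0.
rewrite big_cons exprS; apply: ler_pM => //; [exact: ltW | by rewrite exprn_ge0// ltW | ].
apply: le_trans (villain_weight_ge _ b0); rewrite ler_expR.
rewrite !mulNr lerN2 ler_wpM2l//; first by rewrite divr_ge0// ltW.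
rewrite -[leLHS]real_normK ?num_real// ler_sqr ?nnegrE ?mulr_ge0 ?pi_ge0//.
by rewrite (le_trans (ler_normB _ _))//; have := ang e.1; have := ang e.2; lra.
Qed.

(** The last hypothesis says that [B] screens the rest: unrotated edges avoid the vertices of [s']
    off [B], so [D] vanishes there. Hence [dlt y - D] is an admissible fixed charge in
    [orient_count_lieb]. *)
Lemma lieb_cos_integral b s s' C E (B : seq V) x y : 0 < b -> uniq s -> uniq s' ->
  {subset s' <= s} -> edges_in s' E -> edges_in s C -> {in E, forall e, e.1 != e.2} ->
  x \in s' -> x \notin B -> {subset B <= s'} ->
  (forall v, v \in s' -> v \notin B -> v != y /\ all (fun e => (e.1 != v) && (e.2 != v)) C) ->
  cos_integral b s (C ++ E) (dlt x - dlt y) * cos_integral b s' E 0 <=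
  \sum_(u <- B) cos_integral b s (C ++ E) (dlt u - dlt y) * cos_integral b s' E (dlt x - dlt u) :> R.
Proof.
move=> b0 us us' ss iE iC neE xs xB Bs sep.
have [r0 [r1 [rn lim]]] := @cvg_pair_value R V b b0.
have out0 v : v \notin s' -> (0 : V -> int) v = 0 by [].
have outu u v : u \in s' -> v \notin s' -> (dlt x - dlt u) v = 0.
  move=> us0 vs; rewrite !fun_applyE /dlt.
  have /negPf -> : v != x by apply: contraNneq vs => ->.
  by have /negPf -> : v != u by apply: contraNneq vs => ->.
have l1 := lim _ _ _ _ (dlt x - dlt y) 0 us us' ss iE iC out0.
set c := (2 * pi) ^+ _ in l1.
have l2 : \sum_(u <- B) pair_value s (r0 a) (r1 a) C E (dlt u - dlt y + (dlt x - dlt u))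
      (dlt u - dlt y - (dlt x - dlt u)) * c @[a --> \oo] -->
    \sum_(u <- B) cos_integral b s (C ++ E) (dlt u - dlt y) * cos_integral b s' E (dlt x - dlt u).
  have Bl (B' : seq V) : {subset B' <= s'} -> \sum_(u <- B') pair_value s (r0 a) (r1 a) C E (dlt u - dlt y + (dlt x - dlt u))
      (dlt u - dlt y - (dlt x - dlt u)) * c @[a --> \oo] -->
    \sum_(u <- B') cos_integral b s (C ++ E) (dlt u - dlt y) * cos_integral b s' E (dlt x - dlt u).
    elim: B' => [|u B' IH] Bs'.
      by rewrite big_nil; under eq_fun do rewrite big_nil; exact: cvg_cst.
    rewrite big_cons; under eq_fun do rewrite big_cons; apply: cvgD.
      by apply: lim => // v; apply: outu; apply: Bs'; rewrite mem_head.
    by apply: IH => v vB; apply: Bs'; rewrite inE vB orbT.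
  exact: Bl.
apply: (cvgn_ler2 l1 l2) => a.
rewrite -mulr_suml ler_pM2r ?exprn_gt0 ?mulr_gt0 ?pi_gt0//.
rewrite !(addr0, subr0) /pair_value exchange_big /= big_seq [leRHS]big_seq; apply: ler_sum => g gC.
rewrite -mulr_sumr ler_wpM2l ?(expand_ge0 (rn a).1 gC)//.
rewrite [leRHS]exchange_big /=.
have Dz v : v \in s' -> v \notin B -> all (fun D => D v == 0) (shifts g.2 : seq (V -> int)).
  move=> vs vB; apply: shifts_out; have [_ /allP h] := sep v vs vB.
  by apply/allP => e eg; apply: h; exact: expand_subset gC _ eg.
have step (D : V -> int) : (forall v, v \in s' -> v \notin B -> D v = 0) ->
    \sum_(F <- parity_families (r1 a) E) weighted_count s F (dlt x - dlt y + D) * weighted_count s F (dlt x - dlt y + D)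
  <= \sum_(u <- B) \sum_(F <- parity_families (r1 a) E)
     weighted_count s F (dlt u - dlt y + (dlt x - dlt u) + D) * weighted_count s F (dlt u - dlt y - (dlt x - dlt u) + D).
  move=> D0; rewrite exchange_big /= big_seq [leRHS]big_seq; apply: ler_sum => F FE.
  have F0 c' : c' \in F -> 0 <= c'.1 := parity_families_ge0 (rn a).2 FE.
  (* In the first factor the charge at [u] cancels, so this factor is the same for all [u] and
     equals one of the two factors on the left. *)
  have -> : \sum_(u <- B) weighted_count s F (dlt u - dlt y + (dlt x - dlt u) + D) * weighted_count s F (dlt u - dlt y - (dlt x - dlt u) + D)
    = weighted_count s F (dlt x - dlt y + D) * \sum_(u <- B) weighted_count s F (dlt u - dlt y - (dlt x - dlt u) + D).
    rewrite mulr_sumr; apply: eq_bigr => u _; congr (weighted_count _ _ _ * _).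
    by apply/funext => v; rewrite !fun_applyE; lia.
  rewrite ler_wpM2l ?weighted_count_ge0//.
  rewrite /weighted_count exchange_big /= big_seq [leRHS]big_seq; apply: ler_sum => c' cF.
  rewrite -mulr_sumr ler_wpM2l ?F0//.
  have cE := parity_families_subset FE cF.
  have -> : dlt x - dlt y + D = dlt x - (dlt y - D).
    by apply/funext => v; rewrite !fun_applyE; lia.
  have Pz v : v \in s' -> v \notin B -> (dlt y - D) v = 0.
    move=> vs vB; rewrite !fun_applyE D0// /dlt; have [/negPf -> _] := sep v vs vB.
    by rewrite subr0.
  have := @orient_count_lieb R V s B c'.2 x (dlt y - D) (ss _ xs) xB (Pz x xs xB).
  have ne' : {in c'.2, forall e, e.1 != e.2} by move=> e /cE/neE.
  move=> /(_ ne') h; apply: le_trans (h _) _.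
    move=> e /cE eE v; have /andP[e1 e2] := allP iE _ eE.
    have vs : v \in [:: e.1; e.2] -> v \in s' by rewrite !inE => /orP[] /eqP ->.
    by move=> /vs vs'; split; [exact: ss | exact: Pz].
  apply: ler_sum => u _; rewrite le_eqVlt; apply/orP; left; apply/eqP; congr (orient_count _ _ _ _).
  by apply/funext => v; rewrite !fun_applyE; lia.
have big (l : seq (V -> int)) : (forall v, v \in s' -> v \notin B -> all (fun D => D v == 0) l) ->
   \sum_(D <- l) \sum_(F <- parity_families (r1 a) E) weighted_count s F (dlt x - dlt y + D) * weighted_count s F (dlt x - dlt y + D)
  <= \sum_(D <- l) \sum_(u <- B) \sum_(F <- parity_families (r1 a) E)
     weighted_count s F (dlt u - dlt y + (dlt x - dlt u) + D) * weighted_count s F (dlt u - dlt y - (dlt x - dlt u) + D).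
  elim: l => [|D l IH] lz; first by rewrite !big_nil.
  rewrite !big_cons; apply: lerD.
    by apply: step => v vs vB; have /= /andP[/eqP] := lz v vs vB.
  by apply: IH => v vs vB; have /= /andP[] := lz v vs vB.
by apply: big; exact: Dz.
Qed.

End CorrelationInequalities.

(** * From integrals to correlations on finite graphs *)

Section FiniteGraphs.
Variables (R : realType) (V : choiceType).
Implicit Types (H K G : graph V) (s : seq V) (b : R).

Definition oriented_edges H : seq (V * V) :=
  [seq e <- [seq (u, v) | u <- vseq H, v <- vseq H] |
    edge H e.1 e.2 && (index e.1 (vseq H) < index e.2 (vseq H))%N].

Lemma mem_vseq H v : finite_set (verts H) -> (v \in vseq H) = (v \in verts H).
Proof. by move=> fH; rewrite /vseq in_fset_set. Qed.

Lemma vseq_uniq H : uniq (vseq H).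
Proof. exact: fset_uniq. Qed.

Lemma mem_oriented_edges H e : e \in oriented_edges H ->
  [/\ edge H e.1 e.2, e.1 \in vseq H & e.2 \in vseq H].
Proof.
by rewrite mem_filter => /andP[/andP[eH _] /allpairsP[uv [us vs ee]]]; rewrite ee in eH *.
Qed.

Lemma villain_densityE H b (t : configuration R H) :
  villain_density b t = edge_product b (oriented_edges H) (angle_of t).
Proof.
rewrite /villain_density /edge_product /oriented_edges big_filter [RHS]big_mkcond.
rewrite big_allpairs /=; apply: eq_bigr => u _.
by rewrite big_mkcond.
Qed.

(* The square forgets the orientation chosen for the edges *)
Lemma sqr_prod_oriented s (adj : rel V) (g : V -> V -> R) :
  uniq s -> symmetric adj -> irreflexive adj -> (forall u v, g u v = g v u) ->
  (\prod_(u <- s) \prod_(v <- s | adj u v && (index u s < index v s)%N) g u v) ^+ 2 =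
  \prod_(u <- s) \prod_(v <- s | adj u v) g u v.
Proof.
move=> us adjC adjI gC; rewrite expr2.
have -> : \prod_(u <- s) \prod_(v <- s | adj u v) g u v =
   (\prod_(u <- s) \prod_(v <- s | adj u v && (index u s < index v s)%N) g u v) *
   (\prod_(u <- s) \prod_(v <- s | adj u v && ~~ (index u s < index v s)%N) g u v).
  rewrite -big_split /=; apply: eq_bigr => u _.
  by rewrite (bigID (fun v => (index u s < index v s)%N)).
congr (_ * _).
transitivity (\prod_(u <- s) \prod_(v <- s) if adj u v && (index u s < index v s)%N then g u v else 1).
  by apply: eq_bigr => u _; rewrite big_mkcond.
rewrite exchange_big /= big_seq [RHS]big_seq; apply: eq_bigr => u uin.
rewrite [RHS]big_mkcond big_seq [RHS]big_seq; apply: eq_bigr => v vin.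
rewrite adjC gC -leqNgt; have [uv|//] := boolP (adj u v).
rewrite /= ltn_neqAle; have -> // : index v s != index u s.
by apply: contraTneq uv => iuv; rewrite (@index_inj _ v s v u vin uin iuv) adjI.
Qed.

Lemma prod_restrict s s' (adj : rel V) (g : V -> V -> R) :
  uniq s -> uniq s' -> {subset s' <= s} ->
  (forall u v, adj u v -> u \in s' /\ v \in s') ->
  \prod_(u <- s) \prod_(v <- s | adj u v) g u v =
  \prod_(u <- s') \prod_(v <- s' | adj u v) g u v.
Proof.
move=> us us' ss adjs.
have sub (F : V -> R) : (forall v, v \notin s' -> F v = 1) -> \prod_(v <- s) F v = \prod_(v <- s') F v.
  move=> F1; rewrite (bigID (fun v => v \in s')) /= [X in _ * X]big1 ?mulr1 => [|v /F1//].
  rewrite -big_filter; apply: perm_big; apply: uniq_perm => //; first exact: filter_uniq.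
  by move=> v; rewrite mem_filter; case: (boolP (v \in s')) => //= vs; rewrite ss.
rewrite sub => [|u us0]; last first.
  by rewrite big1// => v /adjs[uin _]; rewrite uin in us0.
apply: eq_bigr => u _; rewrite big_mkcond [RHS]big_mkcond; apply: sub => v vs.
by case: ifPn => // /adjs[_ vin]; rewrite vin in vs.
Qed.

Definition edge_part (H K : graph V) :=
  [seq e <- oriented_edges H | edge K e.1 e.2].

Definition edge_rest (H K : graph V) :=
  [seq e <- oriented_edges H | ~~ edge K e.1 e.2].

Lemma edge_product_split H K b (f : V -> R) :
  edge_product b (edge_rest H K ++ edge_part H K) f = edge_product b (oriented_edges H) f.
Proof.
rewrite /edge_product [RHS](bigID (fun e => edge K e.1 e.2)) /= mulrC big_cat /=.
by congr (_ * _); rewrite big_filter.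
Qed.

(** The left side orients the edges of [K] by the enumeration of [H], the right side by that of [K].
    Both products are nonnegative, so it is enough to compare their squares, which do not see
    orientations. *)
Lemma edge_product_part H K b (f : V -> R) : 0 < b -> finite_set (verts H) -> subgraph K H ->
  edge_product b (edge_part H K) f = edge_product b (oriented_edges K) f.
Proof.
move=> b0 fH [KH1 KH2]; have fK : finite_set (verts K) by exact: sub_finite_set fH.
have ss : {subset vseq K <= vseq H}.
  by move=> v; rewrite !mem_vseq// !inE => /KH1.
have ge0 E : 0 <= edge_product b E f.
  by apply: prodr_ge0 => e _; rewrite ltW// villain_weight_gt0.
pose g u v := villain_weight b (f u - f v).
have gC u v : g u v = g v u by rewrite /g -villain_weightN opprB.
have endK u v : edge K u v -> u \in vseq K /\ v \in vseq K.
  move=> uv; rewrite !mem_vseq// !inE; split; first exact: edge_verts uv.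
  by apply: (@edge_verts _ K v u); rewrite edge_sym.
have prodE (H' : graph V) (a : pred (V * V)) :
   \prod_(e <- oriented_edges H' | a e) g e.1 e.2 =
   \prod_(u <- vseq H') \prod_(v <- vseq H' | (edge H' u v && a (u, v)) && (index u (vseq H') < index v (vseq H'))%N) g u v.
  rewrite -big_filter /oriented_edges -filter_predI big_filter big_mkcond big_allpairs /=.
  apply: eq_bigr => u _; rewrite [RHS]big_mkcond; apply: eq_bigr => v _ /=.
  by rewrite [a _ && _]andbC andbAC.
apply/eqP; rewrite -(@eqrXn2 _ 2)//; apply/eqP.
rewrite /edge_product big_filter (prodE H (fun e => edge K e.1 e.2)) /=.
have -> : \prod_(e <- oriented_edges K) villain_weight b (f e.1 - f e.2) =
   \prod_(e <- oriented_edges K | predT e) g e.1 e.2 by [].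
rewrite (prodE K predT) /=.
rewrite (sqr_prod_oriented (adj := fun u v => edge H u v && edge K u v))//; first last.
- by move=> u; rewrite !edge_irr.
- by move=> u v; rewrite ![edge _ u v]edge_sym.
- exact: vseq_uniq.
rewrite (sqr_prod_oriented (adj := fun u v => edge K u v && true))//; first last.
- by move=> u; rewrite edge_irr.
- by move=> u v; rewrite ![edge _ u v]edge_sym.
- exact: vseq_uniq.
rewrite (prod_restrict _ (vseq_uniq H) (vseq_uniq K) ss) => [|u v /andP[_ /endK]//].
apply: eq_bigr => u _; apply: eq_bigl => v; rewrite andbT.
by apply/andP/idP => [[]//|uv]; split=> //; exact: KH2.
Qed.

Lemma finite_villain_corrE H b x y : finite_set (verts H) -> verts H x -> verts H y ->
  finite_villain_corr H b x y =
  cos_integral b (vseq H) (oriented_edges H) (dlt x - dlt y) /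
  cos_integral b (vseq H) (oriented_edges H) 0 :> R.
Proof.
move=> fH xH yH.
have xs : x \in vseq H by rewrite mem_vseq// inE.
have ys : y \in vseq H by rewrite mem_vseq// inE.
rewrite /finite_villain_corr /villain_expectation; congr (_ / _).
  apply: (@torus_int_ext _ _ _ (fun t => cos (pairing (vseq H) (dlt x - dlt y) (angle_of t)) *
     edge_product b (oriented_edges H) (angle_of t))) => t _.
  by rewrite villain_densityE pairingD pairingN !pairing_dlt ?vseq_uniq.
apply: (@torus_int_ext _ _ _ (fun t => cos (pairing (vseq H) 0 (angle_of t)) *
     edge_product b (oriented_edges H) (angle_of t))) => t _.
by rewrite villain_densityE pairing0 cos0 mul1r.
Qed.

Lemma eq_cos_integral b s E E' (p : V -> int) :
  (forall f : V -> R, edge_product b E f = edge_product b E' f) ->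
  cos_integral b s E p = cos_integral b s E' p.
Proof. by move=> EE; apply: torus_int_ext => t _; rewrite EE. Qed.

Lemma edges_in_oriented H : edges_in (vseq H) (oriented_edges H).
Proof. by apply/allP => e /mem_oriented_edges[_ -> ->]. Qed.

Lemma edges_in_part H K : finite_set (verts K) -> edges_in (vseq K) (edge_part H K).
Proof.
move=> fK; apply/allP => e; rewrite mem_filter => /andP[eK _].
rewrite !mem_vseq//; apply/andP; split; apply/mem_set; first exact: edge_verts eK.
by apply: (@edge_verts _ K _ e.1); rewrite edge_sym.
Qed.

Lemma edges_in_rest H K : edges_in (vseq H) (edge_rest H K).
Proof.
by apply/allP => e; rewrite mem_filter => /andP[_ /mem_oriented_edges[_ -> ->]].
Qed.

Section Subgraph.
Variables (H K : graph V) (b : R).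
Hypotheses (b0 : 0 < b) (fH : finite_set (verts H)) (KH : subgraph K H).

Let fK : finite_set (verts K).
Proof. exact: sub_finite_set KH.1 fH. Qed.

Let ss : {subset vseq K <= vseq H}.
Proof. by move=> v; rewrite !mem_vseq// !inE => /KH.1. Qed.

Let cosH p : cos_integral b (vseq H) (edge_rest H K ++ edge_part H K) p =
  cos_integral b (vseq H) (oriented_edges H) p.
Proof. by apply: eq_cos_integral => f; exact: edge_product_split. Qed.

Let cosK p : cos_integral b (vseq K) (edge_part H K) p =
  cos_integral b (vseq K) (oriented_edges K) p.
Proof. by apply: eq_cos_integral => f; exact: edge_product_part. Qed.

Let dlt_out u v w : u \in vseq K -> v \in vseq K -> w \notin vseq K -> (dlt u - dlt v) w = 0.
Proof.
move=> uK vK wK; rewrite !fun_applyE /dlt.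
have /negPf -> : w != u by apply: contraNneq wK => ->.
by have /negPf -> : w != v by apply: contraNneq wK => ->.
Qed.

Lemma finite_villain_corr_mono x y : verts K x -> verts K y ->
  finite_villain_corr K b x y <= finite_villain_corr H b x y.
Proof.
move=> xK yK; have xH := KH.1 _ xK; have yH := KH.1 _ yK.
rewrite !finite_villain_corrE// ler_pdivrMr ?cos_integral_gt0// mulrAC ler_pdivlMr ?cos_integral_gt0//.
rewrite mulrC -!cosH -!cosK; apply: ginibre_cos_integral => //; try exact: vseq_uniq.
- exact: edges_in_part.
- exact: edges_in_rest.
- by move=> v; apply: dlt_out; rewrite mem_vseq// inE.
Qed.

(** The last hypothesis is separation in local form: at a vertex of [K] off [B], every edge of [H]
    already belongs to [K], so the edges left over can meet [K] only in [B]. *)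
Lemma finite_villain_corr_lieb (B : seq V) x y : verts K x -> verts H y -> x \notin B ->
  (forall u, u \in B -> verts K u) ->
  (forall v, verts K v -> v \notin B -> v != y /\ forall w, edge H v w -> edge K v w) ->
  finite_villain_corr H b x y <=
  \sum_(u <- B) finite_villain_corr K b x u * finite_villain_corr H b u y.
Proof.
move=> xK yH xB BK sep; have xH := KH.1 _ xK.
have ZH := @cos_integral_gt0 R V b (vseq H) (oriented_edges H) b0.
have ZK := @cos_integral_gt0 R V b (vseq K) (oriented_edges K) b0.
rewrite big_seq (eq_bigr (fun u => cos_integral b (vseq H) (oriented_edges H) (dlt u - dlt y) *
   cos_integral b (vseq K) (oriented_edges K) (dlt x - dlt u) *
   ((cos_integral b (vseq K) (oriented_edges K) 0)^-1 / cos_integral b (vseq H) (oriented_edges H) 0))).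
  rewrite -big_seq -mulr_suml finite_villain_corrE//.
  rewrite mulrA ler_pM2r ?invr_gt0// ler_pdivlMr//.
  have := @lieb_cos_integral R V b (vseq H) (vseq K) (edge_rest H K) (edge_part H K) B x y b0
    (vseq_uniq H) (vseq_uniq K) ss (edges_in_part _ fK) (edges_in_rest _ _).
  rewrite !cosH !cosK; under eq_bigr do rewrite cosH cosK; apply => //.
  - move=> e; rewrite mem_filter => /andP[eK _]; apply: contraTneq eK => ->.
    by rewrite edge_irr.
  - by rewrite mem_vseq// inE.
  - by move=> u /BK uK; rewrite mem_vseq// inE.
  - move=> v; rewrite mem_vseq// inE => vK vB; have [vy vw] := sep v vK vB; split => //.
    apply/allP => e; rewrite mem_filter => /andP[eK /mem_oriented_edges[eH _ _]].
    apply/andP; split; apply: contraNneq eK => ev.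
      by rewrite ev; apply: vw; rewrite -ev.
    by rewrite edge_sym ev; apply: vw; rewrite -ev edge_sym.
move=> u uB; have uK := BK u uB; have uH := KH.1 _ uK.
by rewrite !finite_villain_corrE//; lra.
Qed.

End Subgraph.

Lemma finite_villain_corr_ge0 H b x y : 0 < b -> finite_set (verts H) -> verts H x -> verts H y ->
  0 <= finite_villain_corr H b x y.
Proof.
move=> b0 fH xH yH; rewrite finite_villain_corrE// divr_ge0//.
  by apply: cos_integral_ge0 => //; [exact: vseq_uniq | exact: edges_in_oriented].
by rewrite ltW// cos_integral_gt0.
Qed.

Lemma finite_villain_corr_le1 H b x y : 0 < b -> finite_set (verts H) -> verts H x -> verts H y ->
  finite_villain_corr H b x y <= 1.
Proof.
move=> b0 fH xH yH; rewrite finite_villain_corrE// ler_pdivrMr ?cos_integral_gt0// mul1r.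
apply: le_torus_int; try exact: bounded_measurable_integrand.
move=> t _; rewrite pairing0 cos0 ler_wpM2r ?cos_le1//.
by apply: prodr_ge0 => e _; rewrite ltW// villain_weight_gt0.
Qed.

Lemma finite_villain_corr_diag H b x : 0 < b -> finite_set (verts H) -> verts H x ->
  finite_villain_corr H b x x = 1.
Proof.
by move=> b0 fH xH; rewrite finite_villain_corrE// subrr divff// gt_eqF// cos_integral_gt0.
Qed.

End FiniteGraphs.

(** * Infinite-volume limits and the separating set *)

Section InfiniteGraphs.
Variables (R : realType) (V : choiceType).
Implicit Types (H K G : graph V) (W : set V) (b : R).

(** Edgeless graphs serve as starting points in [exhaustion]: they force given vertices into [H],
    away from the junk value of [angle]. *)
Definition edgeless_rel (u v : V) := false.

Definition edgeless W : graph V :=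
  @Graph V W edgeless_rel (fun _ _ => erefl) (fun _ => erefl)
    (fun u v (uv : edgeless_rel u v) => False_ind _ (Bool.diff_false_true uv)).

Definition union_edge H K : rel V := fun u v => edge H u v || edge K u v.

Lemma union_edge_sym H K : symmetric (union_edge H K).
Proof. by move=> u v; rewrite /union_edge ![edge _ u v]edge_sym. Qed.

Lemma union_edge_irr H K : irreflexive (union_edge H K).
Proof. by move=> u; rewrite /union_edge !edge_irr. Qed.

Lemma union_edge_verts H K u v : union_edge H K u v -> (verts H `|` verts K) u.
Proof. by case/orP => /edge_verts; [left | right]. Qed.

Definition union H K : graph V :=
  Graph (@union_edge_sym H K) (@union_edge_irr H K) (@union_edge_verts H K).

Lemma subgraph_refl H : subgraph H H.
Proof. by split. Qed.

Lemma subgraph_trans K H G : subgraph H K -> subgraph K G -> subgraph H G.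
Proof.
by move=> [HK1 HK2] [KG1 KG2]; split=> [v /HK1/KG1//|u v /HK2/KG2].
Qed.

Lemma subgraph_unionl H K : subgraph H (union H K).
Proof. by split=> [v vH|u v uv]; [left | rewrite /= /union_edge uv]. Qed.

Lemma subgraph_unionr H K : subgraph K (union H K).
Proof. by split=> [v vK|u v uv]; [right | rewrite /= /union_edge uv orbT]. Qed.

Lemma subgraph_edgeless W H : W `<=` verts H -> subgraph (edgeless W) H.
Proof. by split. Qed.

Lemma induced_subgraph G W : subgraph (Defs.induced G W) G.
Proof. by split=> [v []//|u v /and3P[]]. Qed.

Lemma finite_subgraph_union H K G :
  finite_subgraph H G -> finite_subgraph K G -> finite_subgraph (union H K) G.
Proof.
move=> [fH [HG1 HG2]] [fK [KG1 KG2]]; split; first by rewrite finite_setU.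
by split=> [v [/HG1|/KG1]|u v /orP[/HG2|/KG2]].
Qed.

Lemma finite_subgraph_edgeless W G : finite_set W -> W `<=` verts G ->
  finite_subgraph (edgeless W) G.
Proof. by split=> //; exact: subgraph_edgeless. Qed.

Lemma finite_subgraph_trans K H G :
  finite_subgraph H K -> subgraph K G -> finite_subgraph H G.
Proof. by move=> [fH HK] KG; split=> //; exact: subgraph_trans KG. Qed.

Lemma exhaustion_filter G : ProperFilter (exhaustion G).
Proof.
apply: Build_ProperFilter_ex.
  by move=> P [H0 fH0 PH]; exists H0; apply: PH => //; exact: subgraph_refl.
split.
- by exists (edgeless set0) => //; apply: finite_subgraph_edgeless.
- move=> P Q [H0 fH0 PH] [H1 fH1 QH]; exists (union H0 H1).
    exact: finite_subgraph_union.
  move=> H fH HH; split; [apply: PH | apply: QH] => //.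
    exact: subgraph_trans (subgraph_unionl _ _) HH.
  exact: subgraph_trans (subgraph_unionr _ _) HH.
- by move=> P Q PQ [H0 fH0 PH]; exists H0 => // H fH HH; apply/PQ/PH.
Qed.

Section Limit.
Variables (G : graph V) (b : R) (x y : V).
Hypotheses (b0 : 0 < b) (xG : verts G x) (yG : verts G y).

Let corrs : set R := [set finite_villain_corr H b x y | H in
  [set H | [/\ finite_subgraph H G, verts H x & verts H y]]].

Let pair_subgraph : finite_subgraph (edgeless [set x; y]) G.
Proof.
by apply: finite_subgraph_edgeless => // v [->|->].
Qed.

Let has_sup_corrs : has_sup corrs.
Proof.
split; first by exists (finite_villain_corr (edgeless [set x; y]) b x y);
  exists (edgeless [set x; y]) => //; split=> //; [left | right].
by exists 1 => _ [H [[fH _] xH yH] <-]; exact: finite_villain_corr_le1.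
Qed.

Lemma villain_corr_cvg :
  finite_villain_corr H b x y @[H --> exhaustion G] --> villain_corr G b x y.
Proof.
have FF := exhaustion_filter G.
suff cv : finite_villain_corr H b x y @[H --> exhaustion G] --> sup corrs.
  by rewrite /villain_corr (cvg_lim _ cv).
apply/cvgrPdist_lt => e e0.
have [_ [H1 [fH1 xH1 yH1] <-] H1e] := sup_adherent e0 has_sup_corrs.
exists H1 => // H fH H1H.
have xH := H1H.1 _ xH1; have yH := H1H.1 _ yH1.
have le1 : finite_villain_corr H1 b x y <= finite_villain_corr H b x y.
  by apply: finite_villain_corr_mono => //; exact: fH.1.
have le2 : finite_villain_corr H b x y <= sup corrs.
  by apply: ub_le_sup; [exact: has_sup_corrs.2 | exists H].
by rewrite ger0_norm ?subr_ge0//; lra.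
Qed.

Lemma finite_villain_corr_le H : finite_subgraph H G -> verts H x -> verts H y ->
  finite_villain_corr H b x y <= villain_corr G b x y.
Proof.
move=> fH xH yH; have FF := exhaustion_filter G.
rewrite -(cvg_lim _ villain_corr_cvg)//; apply: limr_ge.
  by apply/cvg_ex; eexists; exact: villain_corr_cvg.
exists H => // K fK HK; apply: finite_villain_corr_mono => //; exact: fK.1.
Qed.

Lemma villain_corr_le M : (\forall H \near exhaustion G, finite_villain_corr H b x y <= M) ->
  villain_corr G b x y <= M.
Proof.
move=> le; have FF := exhaustion_filter G.
rewrite -(cvg_lim _ villain_corr_cvg)//; apply: limr_le => //.
by apply/cvg_ex; eexists; exact: villain_corr_cvg.
Qed.

Lemma villain_corr_ge0 : 0 <= villain_corr G b x y.
Proof.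
have xH : verts (edgeless [set x; y]) x by left.
have yH : verts (edgeless [set x; y]) y by right.
apply: le_trans (finite_villain_corr_le pair_subgraph xH yH).
by apply: finite_villain_corr_ge0 => //; exact: pair_subgraph.1.
Qed.

End Limit.

Lemma villain_corr_diag G b x : 0 < b -> verts G x -> villain_corr G b x x = 1.
Proof.
move=> b0 xG; apply/eqP; rewrite eq_le; apply/andP; split.
  apply: villain_corr_le => //; exists (edgeless [set x]).
    by apply: finite_subgraph_edgeless => // v ->.
  by move=> H [fH _] [xH _]; rewrite finite_villain_corr_diag//; exact: xH.
have fx : finite_subgraph (edgeless [set x]) G by apply: finite_subgraph_edgeless => // v ->.
rewrite -(@finite_villain_corr_diag R V (edgeless [set x]) b x)//; last exact: fx.1.
exact: finite_villain_corr_le.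
Qed.

Lemma reachable_avoiding_refl G (B : {fset V}) x : x \notin B -> reachable_avoiding G B x x.
Proof. by move=> xB; exists [::]; rewrite /= orbF. Qed.

Lemma reachable_avoiding_edge G (B : {fset V}) x v w : reachable_avoiding G B x v ->
  edge G v w -> w \notin B -> reachable_avoiding G B x w.
Proof.
move=> [p [pp pv pB]] vw wB; exists (rcons p w).
by rewrite rcons_path pp last_rcons -rcons_cons has_rcons negb_or wB pB pv vw.
Qed.

Lemma villain_corr_sub K G b x y : 0 < b -> subgraph K G -> verts K x -> verts K y ->
  villain_corr K b x y <= villain_corr G b x y.
Proof.
move=> b0 KG xK yK; apply: villain_corr_le => //.
exists (edgeless [set x; y]); first by apply: finite_subgraph_edgeless => // v [->|->].
move=> H fH [HH _]; apply: finite_villain_corr_le => //.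
- exact: KG.1.
- exact: KG.1.
- exact: finite_subgraph_trans KG.
- by apply: HH; left.
- by apply: HH; right.
Qed.

End InfiniteGraphs.

Theorem theorem1p6 (R : realType) (V : choiceType) (G : graph V) (x y : V)
    (B : {fset V}) (beta : R) :
  locally_finite G ->
  verts G x -> verts G y -> [set` B] `<=` verts G ->
  separates G B x y ->
  0 < beta ->
  villain_corr G beta x y <=
    \sum_(u <- B) villain_corr (separated_part G B x) beta x u *
                  villain_corr G beta u y
  /\
  \sum_(u <- B) villain_corr (separated_part G B x) beta x u *
                villain_corr G beta u y <=
    \sum_(u <- B) villain_corr G beta x u * villain_corr G beta u y.
Proof.
move=> _ xG yG BG sepB b0; set GB := separated_part G B x.
have GBG : subgraph GB G := induced_subgraph _ _.
have BGB u : u \in B -> verts GB u by move=> uB; split; [exact: BG | left].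
have xGB : verts GB x.
  split=> //; have [xB|xB] := boolP (x \in B); [by left | right].
  exact: reachable_avoiding_refl.
have BV u : u \in B -> verts G u := fun uB => BG u uB.
split; last first.
  rewrite big_seq [leRHS]big_seq; apply: ler_sum => u uB.
  apply: ler_wpM2r; first by apply: villain_corr_ge0 => //; exact: BV.
  by apply: villain_corr_sub => //; exact: BGB.
have term_ge0 u : u \in B -> 0 <= villain_corr GB beta x u * villain_corr G beta u y.
  move=> uB; apply: mulr_ge0; apply: villain_corr_ge0 => //; [exact: BGB | exact: BV].
have [xB|xB] := boolP (x \in B).
  (* For [x] in [B] the term [u = x] is already the left side, and the other terms are
     nonnegative. *)
  rewrite (big_fsetD1 x)//= villain_corr_diag// mul1r lerDl big_seq.
  by apply: sumr_ge0 => u; rewrite in_fsetD1 => /andP[_ uB]; exact: term_ge0.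
apply: villain_corr_le => //.
(* A bound for large [H] suffices; [H0] ensures that [H] contains [x], [y] and all of [B]. *)
pose H0 := edgeless ([set x; y] `|` [set` B]).
have fH0 : finite_subgraph H0 G.
  apply: finite_subgraph_edgeless; first by rewrite finite_setU; split=> //; exact: finite_fset.
  by move=> v [[->|->]//|/BG].
exists H0 => // H fH [H0H _].
have xH : verts H x by apply: H0H; left; left.
have yH : verts H y by apply: H0H; left; right.
have BH u : u \in B -> verts H u by move=> uB; apply: H0H; right.
(* [K] is the part of [H] on the side of [x]. Being a finite subgraph of [GB] as well, its
   correlations lie below those of [GB]. *)
pose K := Defs.induced H (verts GB).
have KH : subgraph K H := induced_subgraph _ _.
have fK : finite_subgraph K GB.
  split; first exact: sub_finite_set KH.1 fH.1.
  split=> [v []//|u v /and3P[uGB vGB uv]].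
  have [_ uW] := set_mem uGB; have [_ vW] := set_mem vGB.
  by apply/and3P; split; [exact: mem_set | exact: mem_set | exact: fH.2.2].
have xK : verts K x by [].
have BK u : u \in B -> verts K u by move=> uB; split; [exact: BH | exact: BGB].
apply: (@le_trans _ _ (\sum_(u <- B) finite_villain_corr K beta x u * finite_villain_corr H beta u y)).
  (* A vertex of [K] off [B] is reachable avoiding [B]. It is not [y], by separation, and each of
     its neighbours in [H] is in [B] or again reachable, hence in [K]. *)
  apply: (finite_villain_corr_lieb b0 fH.1 KH) => // v [vH [_ vW]] vB.
  case: vW => [vB'|vr]; first by rewrite vB' in vB.
  split.
    apply: contraT => /negPn/eqP vy; have [p [pp pv pB]] := vr.
    by move: (sepB p pp); rewrite pv vy (negPf pB) => /(_ erefl).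
  move=> w vw; apply/and3P; split=> //.
    by apply/mem_set; split; [exact: fH.2.1 | right].
  apply/mem_set; split; first by apply/fH.2.1/(@edge_verts _ H w v); rewrite edge_sym.
  have [wB|wB] := boolP (w \in B); [by left | right].
  exact: reachable_avoiding_edge vr (fH.2.2 _ _ vw) wB.
rewrite big_seq [leRHS]big_seq; apply: ler_sum => u uB.
apply: ler_pM.
- by apply: finite_villain_corr_ge0 => //; [exact: fK.1 | exact: BK].
- by apply: finite_villain_corr_ge0 => //; [exact: fH.1 | exact: BH].
- by apply: finite_villain_corr_le => //; [exact: BGB | exact: BK].
- by apply: finite_villain_corr_le => //; [exact: BV | exact: BH].
Qed.
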